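(* Let $\lambda\in\mathbb{C}$ be generic, and let $P_1\in E_{K3}(\mathbb{C}(t))$ be the point $P_1=(-2t:\lambda(t+1):\lambda(t-1))$. Modulo torsion, the section $A_1'=(P_1)$ of $\varphi:X_\lambda\to\mathbb{P}^1$ generates the Mordell-Weil lattice $\mathrm{MWL}(X_\lambda)$ of sections.
   Context: ''Generic'' means outside a suitable countable set of $\lambda\in\mathbb{C}$, so that in particular $X_\lambda$ has Picard number $19$. $C_\lambda\subset\mathbb{P}^2$ is the nine-cuspidal sextic dual to $E_\lambda:x^3+y^3+z^3-3\lambda xyz=0$, and $X_\lambda$ is the K3 surface which is the minimal desingularization of the double cover of $\mathbb{P}^2$ branched over $C_\lambda$. The natural elliptic fibration $\varphi:X_\lambda\to\mathbb{P}^1$ is the one having the (smooth genus $1$) reduced strict transform of $C_\lambda$ as a fiber. Its generic fiber is the plane cubic over $\mathbb{C}(t)$ $$E_{K3}:\ x^3+y^3+z^3+\frac{\lambda^3(t^2+3)-4t^2}{\lambda^2(t^2-1)}xyz=0 ,$$ with neutral element $Q_1=(0:-1:1)$. For a point $P$ of $E_{K3}$ over $\mathbb{C}(t)$, $(P)\subset X_\lambda$ denotes the corresponding section of $\varphi$; $A_1=(Q_1)$ is the zero section and $A_1'=(P_1)$. $\mathrm{MWL}(X_\lambda)$ denotes the group of sections of $\varphi$ (with the height pairing). *)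

(* Defs.v *)
From mathcomp Require Import all_boot all_order all_algebra.
From mathcomp Require Import boolp classical_sets functions cardinality reals.
From mathcomp Require Import complex.
From mathcomp Require Import ring.

Set Implicit Arguments.
Unset Strict Implicit.
Unset Printing Implicit Defensive.

Import Order.TTheory GRing.Theory Num.Theory.
Local Open Scope ring_scope.

Definition row3 (K : nzRingType) (x y z : K) : 'rV[K]_3 :=
  \row_(j < 3) [tuple x; y; z]`_j.

(* A K-point of the projective plane is a line of K^3, i.e. a subspace of
   dimension 1 of 'rV[K]_3; the point (x : y : z) is <[row3 x y z]>. *)
Section HesseCubic.
Variables (K : fieldType) (m : K).
Implicit Types (u v : 'rV[K]_3) (P Q : {vspace 'rV[K]_3}).

Definition hesse_form u : K :=
  u 0 0 ^+ 3 + u 0 1 ^+ 3 + u 0 2 ^+ 3 + m * (u 0 0 * u 0 1 * u 0 2).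

Definition on_hesse P : bool :=
  (\dim P == 1%N) && (hesse_form (vpick P) == 0).

(* The gradient of [hesse_form] at [u], applied to [v]. *)
Definition hesse_polar u v : K :=
  (3 * u 0 0 ^+ 2 + m * (u 0 1 * u 0 2)) * v 0 0
  + (3 * u 0 1 ^+ 2 + m * (u 0 0 * u 0 2)) * v 0 1
  + (3 * u 0 2 ^+ 2 + m * (u 0 0 * u 0 1)) * v 0 2.

Definition hesse_tangential u : 'rV[K]_3 :=
  row3 (u 0 0 * (u 0 1 ^+ 3 - u 0 2 ^+ 3))
       (u 0 1 * (u 0 2 ^+ 3 - u 0 0 ^+ 3))
       (u 0 2 * (u 0 0 ^+ 3 - u 0 1 ^+ 3)).

Lemma hesse_formD u v (a b : K) :
  hesse_form (a *: u + b *: v) =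
    a ^+ 3 * hesse_form u + a ^+ 2 * b * hesse_polar u v
    + a * b ^+ 2 * hesse_polar v u + b ^+ 3 * hesse_form v.
Proof. by rewrite /hesse_form /hesse_polar !mxE; ring. Qed.

Lemma hesse_polar_tangential u : hesse_polar u (hesse_tangential u) = 0.
Proof. by rewrite /hesse_polar !mxE /=; ring. Qed.

Lemma hesse_form_tangential u :
  hesse_form (hesse_tangential u) =
    (u 0 0 ^+ 3 - u 0 1 ^+ 3) * (u 0 1 ^+ 3 - u 0 2 ^+ 3)
    * (u 0 2 ^+ 3 - u 0 0 ^+ 3) * hesse_form u.
Proof. by rewrite /hesse_form !mxE /=; ring. Qed.

(* The residual intersection point of the cubic with the line PQ (the tangent
   line at P if P = Q). By the lemmas above, for u, v on the cubic the form
   restricts to a b (a * polar u v + b * polar v u) on a u + b v, and to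
   a b^2 * polar w u on a u + b w if w is the tangential point of u. *)
Definition hesse_third P Q : {vspace 'rV[K]_3} :=
  let u := vpick P in let v := vpick Q in
  if P == Q then <[hesse_tangential u]>%VS
  else <[hesse_polar v u *: u - hesse_polar u v *: v]>%VS.

(* The neutral element, a flex of the cubic. *)
Definition hesse_zero : {vspace 'rV[K]_3} := <[row3 0 (-1) 1]>%VS.

Definition hesse_add P Q := hesse_third hesse_zero (hesse_third P Q).

Definition hesse_opp P := hesse_third hesse_zero P.

Definition hesse_muln P (n : nat) := iter n (hesse_add P) hesse_zero.

Definition hesse_mulz P (n : int) :=
  match n with
  | Posz k => hesse_muln P k
  | Negz k => hesse_opp (hesse_muln P k.+1)
  end.

Definition hesse_torsion P : Prop :=
  exists2 n : nat, (0 < n)%N & hesse_muln P n = hesse_zero.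

Definition hesse_generates_mod_torsion P : Prop :=
  forall Q, on_hesse Q ->
    exists (n : int) (T : {vspace 'rV[K]_3}),
      [/\ on_hesse T, hesse_torsion T & Q = hesse_add (hesse_mulz P n) T].

End HesseCubic.

Section EK3.
Variable R : realType.

Definition Ct : fieldType := {fraction {poly R[i]}}.

Definition Ct_const (c : R[i]) : Ct := tofrac c%:P.

Definition Ct_t : Ct := tofrac 'X.

(* The sections of the elliptic fibration on the K3 surface are the
   Ct-points of the Hesse cubic with this coefficient of xyz. *)
Definition EK3_coef (lambda : R[i]) : Ct :=
  let l := Ct_const lambda in let t := Ct_t in
  (l ^+ 3 * (t ^+ 2 + 3) - 4 * t ^+ 2) / (l ^+ 2 * (t ^+ 2 - 1)).

Definition EK3_P1 (lambda : R[i]) : {vspace 'rV[Ct]_3} :=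
  let l := Ct_const lambda in let t := Ct_t in
  <[row3 (- 2 * t) (l * (t + 1)) (l * (t - 1))]>%VS.

End EK3.

(* Main.v *)
(* Write the coefficient of xyz as A / B with A, B in C[t], and let Q x Q'
   denote the vector product of the coordinate vector of a section Q, given by
   coprime polynomials of degree d, with its derivative.

   Let lambda be transcendental. Then C has a derivation delta with
   delta lambda = 1, and a combination Theta of delta and d/dt kills A / B.
   Hence Q x Theta Q = c (B grad F)(Q) for a scalar c, and comparing degrees
   shows that c is a constant in C. It is the derivative of the elliptic
   logarithm of Q along Theta; in particular it is additive in Q, which is
   checked on the residual points of lines.

   On the other hand a quadratic expression in Q x Q' gives a constant e (see
   [height_form]). Reading it off at t = 0 and at infinity, the ramification
   points of t -> t^2, where Q x Q' is proportional to c grad F, gives two values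
   of e; their equality reads k1 d = k2 c^2 with k1, k2 independent of Q. So d
   is a quadratic form in c, and d = 1 for P1. With r = c(Q) / c(P1), both
   r^2 and (r + 1)^2 are integers, so r is an integer n. Then Q - n P1 has
   c = 0, so d = 0: its coordinates are constant and it is a flex. *)

Require Import Defs.
From mathcomp Require Import all_boot all_order all_algebra.
From mathcomp Require Import boolp classical_sets functions cardinality reals.
From mathcomp Require Import complex ring.

Set Implicit Arguments.
Unset Strict Implicit.
Unset Printing Implicit Defensive.

Import Order.TTheory GRing.Theory Num.Theory.
Local Open Scope ring_scope.

(** * Algebraic numbers and derivations of a field of characteristic 0 *)

(** Along a level curve of [A / B] in the (lambda, t)-plane the cubic does not change, so a section
    becomes a moving point on a fixed elliptic curve, and its velocity is a multiple of the
    invariant vector field. This needs lambda to vary independently, which is what transcendence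
    provides. Pure d/dt gives no such velocity, but it is what sees the degree: the leading
    coefficient of t p' is the degree times that of p. The two are compared at t = 0 and at infinity
    because [A / B] is a function of t^2: there its derivative in a local parameter vanishes,
    [delta] drops out of Theta, and Theta is a multiple of d/dt. Neither k2 nor c(P1) is ever
    evaluated: as k1 is nonzero, the equation for [P1], of degree 1, forces both to be nonzero. *)

Definition algebraic_over_int (F : numFieldType) : set F :=
  [set x | exists2 p : {poly int}, p != 0 & root (map_poly intr p) x].

Lemma countable_algebraic_over_int (F : numFieldType) :
  countable (@algebraic_over_int F).
Proof.
have -> : @algebraic_over_int F =
    (\bigcup_(p in [set p : {poly int} | p != 0])
      [set x : F | root (map_poly intr p) x])%classic.
  by apply/seteqP; split=> [x [p p0 px]|x [p p0 px]]; exists p.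
apply: bigcup_countable => [|p /= p0]; first exact: countableP.
apply: finite_set_countable.
have q0 : map_poly (intr : int -> F) p != 0.
  apply: contraNneq p0 => pE; apply/eqP/polyP => i.
  have := congr1 (fun q : {poly F} => q`_i) pE.
  by rewrite coef_map_id0 // !coef0 => /eqP; rewrite intr_eq0 => /eqP.
(* If no list held all the roots, distinct roots could be collected beyond the bound
   [max_poly_roots]. *)
have [rs /= [_ sub]] : exists rs : seq F,
    True /\ forall x, root (map_poly (intr : int -> F) p) x -> x \in rs.
  apply: contrapT => nex.
  have ex n : exists rs : seq F, [/\ uniq rs, size rs = n &
      all (root (map_poly intr p)) rs].
    elim: n => [|n [rs [u s a]]]; first by exists [::].
    apply: contrapT => nex1; apply: nex; exists rs; split=> // x px.
    apply: contrapT => /negP xrs; apply: nex1; exists (x :: rs) => /=.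
    by rewrite xrs u s px a.
  have [rs [u s a]] := ex (size (map_poly (intr : int -> F) p)).
  by have := max_poly_roots q0 a u; rewrite s ltnn.
by apply: (@sub_finite_set _ _ [set` rs]) => // x /= /sub.
Qed.

Section DerivationExtension.
Variables (F : numFieldType) (l : F).

(* A set of pairs is read as a set of dual numbers [a + b eps]; a derivation
   on a subring is a set of dual numbers that is a subring and the graph of a
   function. *)
Record derivation_graph (G : set (F * F)) : Prop := {
  dg_one : G (1, 0);
  dg_gen : G (l, 1);
  dg_sub : forall a b a' b', G (a, b) -> G (a', b') -> G (a - a', b - b');
  dg_mul : forall a b a' b', G (a, b) -> G (a', b') ->
    G (a * a', a * b' + b * a');
  dg_fun : forall b, G (0, b) -> b = 0 }.

Lemma dg_zero G : derivation_graph G -> G (0, 0).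
Proof. by move=> hG; have := dg_sub hG (dg_one hG) (dg_one hG); rewrite !subrr. Qed.

Lemma dg_opp G a b : derivation_graph G -> G (a, b) -> G (- a, - b).
Proof. by move=> hG Gab; have := dg_sub hG (dg_zero hG) Gab; rewrite !sub0r. Qed.

Lemma dg_add G a b a' b' : derivation_graph G ->
  G (a, b) -> G (a', b') -> G (a + a', b + b').
Proof.
by move=> hG Gab /(dg_opp hG) Gab'; have := dg_sub hG Gab Gab'; rewrite !opprK.
Qed.

Lemma dg_muln G a b n : derivation_graph G -> G (a, b) -> G (a *+ n, b *+ n).
Proof.
move=> hG Gab; elim: n => [|n IH]; first exact: dg_zero.
by rewrite !mulrSr; apply: dg_add.
Qed.

Lemma dg_sum G (I : Type) (r : seq I) (f g : I -> F) : derivation_graph G ->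
  (forall i, G (f i, g i)) -> G (\sum_(i <- r) f i, \sum_(i <- r) g i).
Proof.
move=> hG fg; elim: r => [|i r IH]; first by rewrite !big_nil; exact: dg_zero.
by rewrite !big_cons; apply: dg_add.
Qed.

(** [f + g eps] read as a polynomial over the ring of dual numbers [G]; [g] differentiates only the
    coefficients of [f]. *)
Definition dg_poly (G : set (F * F)) (f g : {poly F}) :=
  forall i, G (f`_i, g`_i).

Lemma dg_polyM G f g f' g' : derivation_graph G -> dg_poly G f g ->
  dg_poly G f' g' -> dg_poly G (f * f') (f * g' + g * f').
Proof.
move=> hG hf hf' i; rewrite coefD !coefM -big_split /=.
by apply: dg_sum => // j; apply: dg_mul.
Qed.

Lemma dg_polyC G a b : derivation_graph G -> G (a, b) -> dg_poly G a%:P b%:P.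
Proof. by move=> hG hab [|i]; rewrite !coefC //=; apply: dg_zero. Qed.

Lemma dg_polyXn G n : derivation_graph G -> dg_poly G 'X^n 0.
Proof.
move=> hG i; rewrite coefXn coef0; case: eqP => _; first exact: dg_one.
exact: dg_zero.
Qed.

Lemma dg_poly_sub G f g f' g' : derivation_graph G -> dg_poly G f g ->
  dg_poly G f' g' -> dg_poly G (f - f') (g - g').
Proof. by move=> hG hf hf' i; rewrite !coefB; apply: dg_sub. Qed.

(** The values at [x + y eps] of the polynomials over [G]; the second component is the chain
    rule. *)
Definition dg_adjoin (G : set (F * F)) (x y : F) : set (F * F) :=
  [set c | exists f g, dg_poly G f g /\ c = (f.[x], g.[x] + f^`().[x] * y)].

Lemma dg_adjoin_sub G x y c : derivation_graph G -> G c -> dg_adjoin G x y c.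
Proof.
case: c => a b hG Gab; exists a%:P, b%:P; split; first exact: dg_polyC.
by rewrite !hornerC derivC horner0 mul0r addr0.
Qed.

Lemma dg_adjoin_mem G x y : derivation_graph G -> dg_adjoin G x y (x, y).
Proof.
move=> hG; exists 'X, 0; split; first exact: (@dg_polyXn _ 1).
by rewrite derivX !hornerE.
Qed.

(** The image of a ring under evaluation is a ring, so the one condition left is that 0 has no
    derivative other than 0. *)
Lemma dg_adjoinP G x y : derivation_graph G ->
  (forall f g, dg_poly G f g -> f.[x] = 0 -> g.[x] + f^`().[x] * y = 0) ->
  derivation_graph (dg_adjoin G x y).
Proof.
move=> hG hxy; split.
- by apply: dg_adjoin_sub => //; exact: dg_one.
- by apply: dg_adjoin_sub => //; exact: dg_gen.
- move=> a b a' b' [f [g [fg [-> ->]]]] [f' [g' [fg' [-> ->]]]].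
  exists (f - f'), (g - g'); split; first exact: dg_poly_sub.
  by rewrite derivB !hornerE; congr (_, _); ring.
- move=> a b a' b' [f [g [fg [-> ->]]]] [f' [g' [fg' [-> ->]]]].
  exists (f * f'), (f * g' + g * f'); split; first exact: dg_polyM.
  by rewrite derivM !hornerE; congr (_, _); ring.
- by move=> b [f [g [fg [f0 ->]]]]; apply: hxy.
Qed.

(* At a transcendental [x] any [y] works; at an algebraic [x] the value of the
   derivation is forced by a polynomial of least degree vanishing at [x]. *)
Lemma dg_adjoin_exists G x : derivation_graph G ->
  exists y, derivation_graph (dg_adjoin G x y).
Proof.
move=> hG.
pose annihilator n := exists f g, [/\ dg_poly G f g, f != 0, f.[x] = 0 & size f = n].
have [[n0 ann0]|trans] := pselect (exists n, annihilator n); last first.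
  exists 0; apply: dg_adjoinP => // f g fg fx0.
  have f0 : f = 0.
    apply/eqP; apply: contrapT => /negP f0; apply: trans.
    by exists (size f), f, g.
  rewrite f0 deriv0 horner0 mul0r addr0; suff -> : g = 0 by rewrite horner0.
  apply/polyP => i; rewrite coef0; apply: (dg_fun hG).
  by have := fg i; rewrite f0 coef0.
have ex : exists n, `[< annihilator n >] by exists n0; apply/asboolP.
case: (ex_minnP ex) => n /asboolP [f [g [fg f0 fx0 fn]]] min_n.
have sf1 : (1 < size f)%N.
  rewrite ltnNge; apply/negP => /size1_polyC fE; move: fx0 f0.
  by rewrite fE hornerC => ->; rewrite eqxx.
(* Otherwise the derivative of [f], nonzero in characteristic 0, would be an annihilator of smaller
   degree. *)
have df0 : f^`().[x] != 0.
  apply/eqP => dfx0; have f'0 : f^`() != 0.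
    apply: contraTneq sf1 => df; rewrite -leqNgt.
    suff -> : f = (f`_0)%:P by exact: size_polyC_leq1.
    apply/polyP => -[|i]; rewrite coefC //=; apply/eqP.
    have := congr1 (fun p : {poly F} => p`_i) df.
    by rewrite coef_deriv coef0 => /eqP; rewrite mulrn_eq0.
  have /min_n : `[< annihilator (size f^`()) >].
    apply/asboolP; exists f^`(), g^`(); split=> // i; rewrite !coef_deriv.
    exact: dg_muln.
  by rewrite -fn leqNgt lt_size_deriv.
pose y := - g.[x] / f^`().[x]; exists y; apply: dg_adjoinP => //.
have fy : g.[x] + f^`().[x] * y = 0 by rewrite /y; field.
move=> h k; have [N] := ubnP (size h); elim: N h k => // N IH h k shN hk hx0.
have [h0|h0] := eqVneq h 0.
  rewrite h0 deriv0 horner0 mul0r addr0; suff -> : k = 0 by rewrite horner0.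
  apply/polyP => i; rewrite coef0; apply: (dg_fun hG).
  by have := hk i; rewrite h0 coef0.
have fh : (size f <= size h)%N.
  by rewrite fn; apply: min_n; apply/asboolP; exists h, k.
(* One step of pseudo-division of [h] by [f], carried out on dual numbers: [k1] is the second
   component of [h1]. Leading coefficients are multiplied across because [G] is only a ring. *)
pose e := (size h - size f)%N.
pose fa := lead_coef f; pose fb := g`_(size f).-1.
pose ha := lead_coef h; pose hb := k`_(size h).-1.
pose h1 := fa%:P * h - ha%:P * ('X^e * f).
pose k1 := (fa%:P * k + fb%:P * h) - (ha%:P * ('X^e * g + 0 * f) + hb%:P * ('X^e * f)).
have hk1 : dg_poly G h1 k1.
  apply: dg_poly_sub => //; apply: dg_polyM => //.
  - by apply: dg_polyC => //; exact: fg.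
  - by apply: dg_polyC => //; exact: hk.
  - by apply: dg_polyM => //; exact: dg_polyXn.
have fa0 : fa != 0 by rewrite lead_coef_eq0.
  have h1x : h1.[x] = 0.
    by rewrite /h1 !(hornerD, hornerN, hornerM, hornerC) hx0 fx0; ring.
have sh1 : (size h1 < N)%N.
  have sXf : size ('X^e * f) = size h.
    by rewrite size_monicM ?monicXn // size_polyXn /= subnK.
  have sh0 : (0 < size h)%N by rewrite size_poly_gt0.
  suff : (size h1 <= (size h).-1)%N.
    move=> s1; rewrite -ltnS; apply: leq_ltn_trans shN.
    by rewrite -(prednK sh0) ltnS.
  apply/leq_sizeP => j; rewrite leq_eqVlt => /orP[/eqP <-|jh].
    rewrite coefB !coefCM coefXnM; have -> : ((size h).-1 < e)%N = false.
      by apply/negbTE; rewrite -leqNgt /e -subn1 leq_sub2l // ltnW.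
    have -> : ((size h).-1 - e = (size f).-1)%N.
      by rewrite /e -!subn1 subnAC subKn.
    by rewrite /fa /ha /lead_coef mulrC subrr.
  have hj : (size h <= j)%N by rewrite -(prednK sh0).
  by rewrite coefB !coefCM [h`_j]nth_default // [('X^e * f)`_j]nth_default ?sXf // !mulr0 subr0.
have := IH h1 k1 sh1 hk1 h1x.
rewrite /h1 /k1 !(derivB, derivM, derivC) !(hornerD, hornerN, hornerM, hornerC, horner0) hx0 fx0 => E.
have gx : g.[x] = - (f^`().[x] * y) by apply/eqP; rewrite -addr_eq0 fy.
rewrite gx in E.
by apply: (mulfI fa0); rewrite mulr0 -[RHS]E; ring.
Qed.

(** Zorn's lemma for derivation graphs under inclusion: by [dg_adjoin_exists] a maximal one is
    defined everywhere. Transcendence makes the values of integer polynomials at [l] a starting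
    point, since such a value then determines the polynomial. *)
Lemma derivation_exists : ~ algebraic_over_int l ->
  exists D : F -> F, [/\ {morph D : x y / x + y},
    forall x y, D (x * y) = x * D y + D x * y & D l = 1].
Proof.
move=> tr.
pose base : set (F * F) := [set c | exists p : {poly int},
  c = ((map_poly intr p).[l], (map_poly intr p)^`().[l])]%classic.
have base_dg : derivation_graph base.
  split.
  - by exists 1; rewrite rmorph1 derivC !hornerE.
  - by exists 'X; rewrite map_polyX derivX !hornerE.
  - move=> a b a' b' [p [-> ->]] [q [-> ->]]; exists (p - q).
    by rewrite rmorphB derivB !hornerE.
  - move=> a b a' b' [p [-> ->]] [q [-> ->]]; exists (p * q).
    by rewrite rmorphM derivM !hornerE; congr (_, _); ring.
  - move=> b [p [p0 ->]]; suff -> : p = 0 by rewrite rmorph0 deriv0 horner0.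
    apply/eqP; apply: contrapT => /negP pn0; apply: tr; exists p => //.
    by apply/eqP.
pose P (G : set (F * F)) := G = set0 \/ derivation_graph G.
have chain (S : set (set (F * F))) : (S `<=` P)%classic ->
    total_on S subset -> P (\bigcup_(X in S) X)%classic.
  move=> SP tot.
  have [[G0 [SG0 hG0]]|none] := pselect (exists G, S G /\ derivation_graph G); last first.
    left; apply/seteqP; split=> // c [G SG Gc]; apply: none; exists G; split=> //.
    by case: (SP G SG) => // GE; move: Gc; rewrite GE.
  have dgS G c : S G -> G c -> derivation_graph G.
    by move=> SG Gc; case: (SP G SG) => // GE; move: Gc; rewrite GE.
  have two c c' : (\bigcup_(X in S) X)%classic c -> (\bigcup_(X in S) X)%classic c' ->
      exists G, [/\ S G, derivation_graph G, G c & G c'].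
    move=> [G SG Gc] [G' SG' Gc'].
    have hG := dgS _ _ SG Gc; have hG' := dgS _ _ SG' Gc'.
    have [GG'|G'G] := tot G G' SG SG'.
      by exists G'; split=> //; apply: GG'.
    by exists G; split=> //; apply: G'G.
  right; split.
  - by exists G0 => //; exact: dg_one.
  - by exists G0 => //; exact: dg_gen.
  - move=> a b a' b' hab hab'; have [G [SG hG Gab Gab']] := two _ _ hab hab'.
    by exists G => //; apply: dg_sub.
  - move=> a b a' b' hab hab'; have [G [SG hG Gab Gab']] := two _ _ hab hab'.
    by exists G => //; apply: dg_mul.
  - by move=> b [G SG Gb]; apply: (dg_fun (dgS _ _ SG Gb)).
have [G [PG maxG]] := Zorn_bigcup chain.
have hG : derivation_graph G.
  case: PG => // G0; exfalso; apply: (maxG base); last by right.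
  rewrite G0; split=> // sub; exact: (sub _ (dg_one base_dg)).
have total x : exists y, G (x, y).
  have [y hy] := dg_adjoin_exists x hG; exists y.
  apply: contrapT => nG; apply: (maxG (dg_adjoin G x y)); last by right.
  split=> [c|sub]; last by apply: nG; apply: sub; exact: dg_adjoin_mem.
  exact: dg_adjoin_sub.
have uniq x y y' : G (x, y) -> G (x, y') -> y = y'.
  move=> Gy Gy'; apply/eqP; rewrite -subr_eq0; apply/eqP/(dg_fun hG).
  by have := dg_sub hG Gy Gy'; rewrite subrr.
have [D GD] := choice total; exists D; split.
- by move=> x y; apply: (uniq (x + y)) => //; apply: dg_add.
- by move=> x y; apply: (uniq (x * y)) => //; apply: dg_mul.
- by apply: (uniq l) => //; exact: dg_gen.
Qed.

End DerivationExtension.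

(** * Lines in the space of row vectors of length 3 *)

Section Line.
Variable K : fieldType.
Implicit Types u v : 'rV[K]_3.

Lemma row3_eqP u v :
  u = v <-> [/\ u 0 0 = v 0 0, u 0 1 = v 0 1 & u 0 2 = v 0 2].
Proof.
split=> [->//|[e0 e1 e2]]; apply/rowP => -[[|[|[|//]]] i3].
- by rewrite (_ : Ordinal i3 = 0) ?e0 //; apply: val_inj.
- by rewrite (_ : Ordinal i3 = 1) ?e1 //; apply: val_inj.
- by rewrite (_ : Ordinal i3 = 2) ?e2 //; apply: val_inj.
Qed.

Lemma row3_0 (x y z : K) : row3 x y z 0 0 = x. Proof. by rewrite mxE. Qed.
Lemma row3_1 (x y z : K) : row3 x y z 0 1 = y. Proof. by rewrite mxE. Qed.
Lemma row3_2 (x y z : K) : row3 x y z 0 2 = z. Proof. by rewrite mxE. Qed.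

Lemma row3_neq0 u : u != 0 -> [|| u 0 0 != 0, u 0 1 != 0 | u 0 2 != 0].
Proof.
apply: contraNT; rewrite !negb_or !negbK => /and3P[/eqP e0 /eqP e1 /eqP e2].
by apply/eqP/row3_eqP; rewrite !mxE.
Qed.

Lemma vline_scale (k : K) u : k != 0 -> <[k *: u]>%VS = <[u]>%VS.
Proof.
move=> k0; apply/eqP; rewrite eqEsubv -!memvE; apply/andP; split.
  exact: rpredZ (memv_line _).
by rewrite -{1}[u](scalerK k0) rpredZ ?memv_line.
Qed.

Lemma vline_eqP u v : u != 0 ->
  <[u]>%VS = <[v]>%VS -> exists2 k, k != 0 & u = k *: v.
Proof.
move=> u0 uv; have : u \in <[v]>%VS by rewrite -uv memv_line.
by move=> /vlineP[k uE]; exists k => //; apply: contra_neq u0 => k0; rewrite uE k0 scale0r.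
Qed.

Lemma vpick_line u : u != 0 -> exists2 k, k != 0 & vpick <[u]>%VS = k *: u.
Proof.
move=> u0; have /vlineP[k kE] := memv_pick <[u]>%VS; exists k => //.
have : vpick <[u]>%VS != 0 by rewrite vpick0 -dimv_eq0 dim_vline u0.
by apply: contra_neq => k0; rewrite kE k0 scale0r.
Qed.

Definition cross u v : 'rV[K]_3 :=
  row3 (u 0 1 * v 0 2 - u 0 2 * v 0 1) (u 0 2 * v 0 0 - u 0 0 * v 0 2)
       (u 0 0 * v 0 1 - u 0 1 * v 0 0).

Lemma cross_eq0 u v : u != 0 -> cross u v = 0 -> exists k, v = k *: u.
Proof.
have key (a b c d : K) : a != 0 -> a * d = b * c -> d = c / a * b.
  by move=> a0 ad; apply: (mulfI a0); rewrite ad; field.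
move=> /row3_neq0 u0 /row3_eqP; rewrite !(row3_0, row3_1, row3_2, mxE).
move=> -[/eqP + /eqP + /eqP]; rewrite !subr_eq0 => /eqP c0 /eqP c1 /eqP c2.
case/or3P: u0 => u0; [exists (v 0 0 / u 0 0)|exists (v 0 1 / u 0 1)|
  exists (v 0 2 / u 0 2)]; apply/row3_eqP; rewrite !mxE; split;
  apply: key => //; first [exact: mulrC | exact: c0 | exact: c1 | exact: c2
    | exact: esym c0 | exact: esym c1 | exact: esym c2].
Qed.

Lemma vline_eq_cross u v : u != 0 -> v != 0 -> cross u v = 0 -> <[u]>%VS = <[v]>%VS.
Proof.
move=> u0 v0 /(cross_eq0 u0)[k vE]; rewrite vE vline_scale //.
by apply: contra_neq v0 => k0; rewrite vE k0 scale0r.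
Qed.

End Line.

(** * The third point operation *)

Section HesseThird.
Variables (K : fieldType) (m : K).
Hypothesis K6 : 6 != 0 :> K.
Hypothesis m_smooth : m ^+ 3 + 27 != 0.
Implicit Types (u v w : 'rV[K]_3) (P Q : {vspace 'rV[K]_3}).

Let K2 : 2 != 0 :> K.
Proof.
apply: contra_neq K6 => K20.
have -> : 6 = 2 * 3 :> K by ring.
by rewrite K20 mul0r.
Qed.

Lemma hesse_formZ (k : K) u : hesse_form m (k *: u) = k ^+ 3 * hesse_form m u.
Proof. by rewrite /hesse_form !mxE; ring. Qed.

Lemma hesse_polarZ (k l : K) u v :
  hesse_polar m (k *: u) (l *: v) = k ^+ 2 * l * hesse_polar m u v.
Proof. by rewrite /hesse_polar !mxE; ring. Qed.

Lemma hesse_tangentialZ (k : K) u :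
  hesse_tangential (k *: u) = k ^+ 4 *: hesse_tangential u.
Proof. by apply/row3_eqP; rewrite /hesse_tangential !(row3_0, row3_1, row3_2, mxE); split; ring. Qed.

Lemma on_hesse_line u : u != 0 -> on_hesse m <[u]>%VS = (hesse_form m u == 0).
Proof.
move=> u0; rewrite /on_hesse dim_vline u0 /=; have [k k0 ->] := vpick_line u0.
by rewrite hesse_formZ mulf_eq0 expf_eq0 (negPf k0).
Qed.

Lemma on_hesseP P : on_hesse m P ->
  exists u, [/\ u != 0, hesse_form m u = 0 & P = <[u]>%VS].
Proof.
move=> /andP[dP FP]; exists (vpick P); split; last 2 first.
- exact/eqP.
- by apply/esym/eqP; rewrite eqEdim -memvE memv_pick (eqP dP) dim_vline vpick0 -dimv_eq0 (eqP dP).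
- by rewrite vpick0 -dimv_eq0 (eqP dP).
Qed.

Lemma hesse_third_tangent u : u != 0 ->
  hesse_third m <[u]>%VS <[u]>%VS = <[hesse_tangential u]>%VS.
Proof.
move=> u0; rewrite /hesse_third eqxx; have [k k0 ->] := vpick_line u0.
by rewrite hesse_tangentialZ vline_scale // expf_neq0.
Qed.

Lemma hesse_third_secant u v : u != 0 -> v != 0 -> <[u]>%VS != <[v]>%VS ->
  hesse_third m <[u]>%VS <[v]>%VS =
    <[hesse_polar m v u *: u - hesse_polar m u v *: v]>%VS.
Proof.
move=> u0 v0 uv; rewrite /hesse_third (negPf uv).
have [k k0 ->] := vpick_line u0; have [l l0 ->] := vpick_line v0.
rewrite !hesse_polarZ.
rewrite -[RHS](@vline_scale _ (k ^+ 2 * l ^+ 2)) ?mulf_neq0 ?expf_neq0 //.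
by congr (<[_]>%VS); apply/row3_eqP; rewrite !mxE; split; ring.
Qed.

(** If the tangential vector vanishes and no coordinate does, the three cubes agree, so
    [m * (x * y * z) = - 3 * x ^+ 3], and cubing contradicts smoothness. If one coordinate vanishes,
    the cubic makes a second and then the third vanish. *)
Lemma hesse_tangential_neq0 u : u != 0 -> hesse_form m u = 0 ->
  hesse_tangential u != 0.
Proof.
move=> u0; rewrite /hesse_form.
apply: contra_eq_neq => /row3_eqP; rewrite /hesse_tangential !(row3_0, row3_1, row3_2, mxE).
move: (row3_neq0 u0); move: (u 0 0) (u 0 1) (u 0 2) => x y z xyz [tx ty tz].
have cancel_pow (a b : K) : a * (b ^+ 3) = 0 -> (a == 0) || (b == 0).
  by move=> /eqP; rewrite mulf_eq0 expf_eq0.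
have sq0 (a b : K) : a ^+ 3 + b ^+ 3 = 0 -> (a == 0) || (b == 0) -> (a == 0) && (b == 0).
  move=> ab; case/orP=> /eqP e; move: ab; rewrite e eqxx.
    by rewrite expr0n add0r => /eqP; rewrite expf_eq0.
  by rewrite expr0n addr0 => /eqP; rewrite expf_eq0 andbT.
have [x0|x0] := eqVneq x 0.
  move: xyz ty; rewrite x0 eqxx /= => yz ty; apply/eqP => F0.
  have /andP[/eqP y0 /eqP z0] : (y == 0) && (z == 0).
    apply: sq0; last by apply: cancel_pow; rewrite -ty; ring.
    by rewrite -F0; ring.
  by move: yz; rewrite y0 z0 eqxx.
have [y0|y0] := eqVneq y 0.
  move: tx; rewrite y0 => tx; apply/eqP => F0.
  have /andP[/eqP x00 /eqP z0] : (x == 0) && (z == 0).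
    apply: sq0; last by apply: cancel_pow; rewrite -[RHS]oppr0 -tx; ring.
    by rewrite -F0; ring.
  by rewrite x00 eqxx in x0.
have [z0|z0] := eqVneq z 0.
  move: tx; rewrite z0 => tx; apply/eqP => F0.
  have /andP[/eqP x00 /eqP y00] : (x == 0) && (y == 0).
    apply: sq0; last by apply: cancel_pow; rewrite -tx; ring.
    by rewrite -F0; ring.
  by rewrite x00 eqxx in x0.
have yz : y ^+ 3 = z ^+ 3 by apply/eqP; rewrite -subr_eq0; apply/eqP/(mulfI x0); rewrite tx mulr0.
have zx : z ^+ 3 = x ^+ 3 by apply/eqP; rewrite -subr_eq0; apply/eqP/(mulfI y0); rewrite ty mulr0.
apply/eqP => F0; have e : m * (x * y * z) = - 3 * x ^+ 3.
  apply/eqP; rewrite -subr_eq0 -F0 yz zx; apply/eqP; ring.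
have : m ^+ 3 * (x * y * z) ^+ 3 + 27 * (x * y * z) ^+ 3 = 0.
  by rewrite -exprMn e !exprMn yz zx; ring.
move=> /eqP; rewrite -mulrDl mulf_eq0 (negPf m_smooth) expf_eq0 /=.
by rewrite !mulf_eq0 (negPf x0) (negPf y0) (negPf z0).
Qed.

(* A line that does not pass through (0 : 0 : 1) joins (1 : 0 : a) to
   (0 : 1 : b). *)
Lemma hesse_no_graph_line (a b : K) :
  (forall s t : K, s ^+ 3 + t ^+ 3 + (s * a + t * b) ^+ 3
    + m * (s * t * (s * a + t * b)) = 0) -> False.
Proof.
move=> h.
have ha : 1 + a ^+ 3 = 0 by rewrite -(h 1 0); ring.
have hb : 1 + b ^+ 3 = 0 by rewrite -(h 0 1); ring.
(* From the points (1, 1) and (1, -1). Either [m = - 3 a b], whose cube is -27, or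
   [a + b = a - b = 0], against [1 + a ^+ 3 = 0]. *)
have hs : (3 * (a * b) + m) * (a + b) = 0.
  have -> : (3 * (a * b) + m) * (a + b) = 1 ^+ 3 + 1 ^+ 3 + (1 * a + 1 * b) ^+ 3
      + m * (1 * 1 * (1 * a + 1 * b)) - (1 + a ^+ 3) - (1 + b ^+ 3) by ring.
  by rewrite h ha hb !subr0.
have hd : (3 * (a * b) + m) * (a - b) = 0.
  have -> : (3 * (a * b) + m) * (a - b) = (1 + a ^+ 3) - (1 + b ^+ 3)
      - (1 ^+ 3 + (-1) ^+ 3 + (1 * a + -1 * b) ^+ 3
         + m * (1 * -1 * (1 * a + -1 * b))) by ring.
  by rewrite h ha hb !subr0.
have [e|ne] := eqVneq (3 * (a * b) + m) 0.
  move: m_smooth; apply/negP; rewrite negbK; apply/eqP.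
  have -> : m = - (3 * (a * b)) by apply/eqP; rewrite -addr_eq0 addrC e.
  have -> : (- (3 * (a * b))) ^+ 3 + 27 = 27 * (1 - a ^+ 3 * b ^+ 3) by ring.
  have -> : a ^+ 3 = -1 by apply/eqP; rewrite -addr_eq0 addrC ha.
  have -> : b ^+ 3 = -1 by apply/eqP; rewrite -addr_eq0 addrC hb.
  ring.
have a0 : a = 0.
  apply: (mulfI K2); rewrite mulr0; apply: (mulfI ne); rewrite mulr0.
  have -> : (3 * (a * b) + m) * (2 * a) =
    (3 * (a * b) + m) * (a + b) + (3 * (a * b) + m) * (a - b) by ring.
  by rewrite hs hd addr0.
by have := ha; rewrite a0 expr0n addr0 => /eqP; rewrite oner_eq0.
Qed.

(** If both polars vanished, the line would lie on the cubic by [hesse_formD]. A nonzero minor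
    allows two coordinates as parameters of the line, the situation of [hesse_no_graph_line]. *)
Lemma hesse_no_line u v : u != 0 -> v != 0 -> <[u]>%VS != <[v]>%VS ->
  hesse_form m u = 0 -> hesse_form m v = 0 -> hesse_polar m u v = 0 ->
  hesse_polar m v u != 0.
Proof.
move=> u0 v0 uv Fu Fv puv; apply/eqP => pvu.
have F0 s t : (s * u 0 0 + t * v 0 0) ^+ 3 + (s * u 0 1 + t * v 0 1) ^+ 3
    + (s * u 0 2 + t * v 0 2) ^+ 3 + m * ((s * u 0 0 + t * v 0 0)
      * (s * u 0 1 + t * v 0 1) * (s * u 0 2 + t * v 0 2)) = 0.
  have : hesse_form m (s *: u + t *: v) = 0.
    by rewrite hesse_formD Fu Fv puv pvu !mulr0 !addr0.
  by rewrite /hesse_form !mxE.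
have : cross u v != 0 by apply: contra_neq uv; exact: vline_eq_cross.
move=> /row3_neq0; rewrite /cross !(row3_0, row3_1, row3_2).
have graph (f g h f' g' h' : K) :
    (forall s t, (s * f + t * f') ^+ 3 + (s * g + t * g') ^+ 3 + (s * h + t * h') ^+ 3
      + m * ((s * f + t * f') * (s * g + t * g') * (s * h + t * h')) = 0) ->
    f * g' - g * f' != 0 -> False.
  move=> G0 d0.
  apply: (@hesse_no_graph_line ((h * g' - h' * g) / (f * g' - g * f'))
                               ((h' * f - h * f') / (f * g' - g * f'))) => s t.
  rewrite -[RHS](G0 ((s * g' - t * f') / (f * g' - g * f'))
                    ((t * f - s * g) / (f * g' - g * f'))).
  by field.
case/or3P=> d0.
- by apply: (graph _ _ (u 0 0) _ _ (v 0 0) _ d0) => s t; rewrite -(F0 s t); ring.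
- by apply: (graph _ _ (u 0 1) _ _ (v 0 1) _ d0) => s t; rewrite -(F0 s t); ring.
- by apply: (graph _ _ (u 0 2) _ _ (v 0 2) _ d0) => s t; rewrite -(F0 s t); ring.
Qed.

(* Residual intersection of the tangent at [u] with the cubic, computed from a
   second point [v] of the tangent. *)
Lemma hesse_tangent_line u v : u != 0 -> v != 0 -> <[u]>%VS != <[v]>%VS ->
  hesse_form m u = 0 -> hesse_form m v = 0 -> hesse_polar m u v = 0 ->
  <[hesse_tangential u]>%VS = <[v]>%VS.
Proof.
move=> u0 v0 uv Fu Fv puv; have pvu := hesse_no_line u0 v0 uv Fu Fv puv.
apply/esym/vline_eq_cross => //; first exact: hesse_tangential_neq0.
move: Fu Fv puv pvu; rewrite /hesse_form /hesse_polar /cross /hesse_tangential.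
rewrite !(row3_0, row3_1, row3_2).
move: (u 0 0) (u 0 1) (u 0 2) (v 0 0) (v 0 1) (v 0 2).
have key (x1 y1 z1 x2 y2 z2 : K) :
  let pvu := (3 * x2 ^+ 2 + m * (y2 * z2)) * x1 + (3 * y2 ^+ 2 + m * (x2 * z2)) * y1
    + (3 * z2 ^+ 2 + m * (x2 * y2)) * z1 in
  x1 ^+ 3 + y1 ^+ 3 + z1 ^+ 3 + m * (x1 * y1 * z1) = 0 ->
  x2 ^+ 3 + y2 ^+ 3 + z2 ^+ 3 + m * (x2 * y2 * z2) = 0 ->
  (3 * x1 ^+ 2 + m * (y1 * z1)) * x2 + (3 * y1 ^+ 2 + m * (x1 * z1)) * y2
    + (3 * z1 ^+ 2 + m * (x1 * y1)) * z2 = 0 ->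
  pvu != 0 -> y2 * (z1 * (x1 ^+ 3 - y1 ^+ 3)) - z2 * (y1 * (z1 ^+ 3 - x1 ^+ 3)) = 0.
  (* [pvu] times the minor is in the ideal of the three equations, with the explicit cofactors
     below; [pvu] is nonzero as the cubic contains no line. *)
  move=> pvu Fu Fv puv p0; apply: (mulfI p0); rewrite mulr0.
  transitivity ((x2 ^+ 3 + y2 ^+ 3 + z2 ^+ 3 + m * (x2 * y2 * z2))
      * (y1 * (z1 * (x1 ^+ 3 - y1 ^+ 3)) - z1 * (y1 * (z1 ^+ 3 - x1 ^+ 3)))
    + (x1 ^+ 3 * y2 * z2 + x1 ^+ 2 * y1 * x2 * z2 + x1 ^+ 2 * z1 * x2 * y2
       - x1 * y1 * z1 * x2 ^+ 2 - y1 ^+ 2 * z1 * y2 ^+ 2 - y1 * z1 ^+ 2 * z2 ^+ 2)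
      * ((3 * x1 ^+ 2 + m * (y1 * z1)) * x2 + (3 * y1 ^+ 2 + m * (x1 * z1)) * y2
        + (3 * z1 ^+ 2 + m * (x1 * y1)) * z2)
    + (- 3 * x1 ^+ 2 * x2 * y2 * z2 + y1 * z1 * x2 ^+ 3 + y1 * z1 * y2 ^+ 3
       + y1 * z1 * z2 ^+ 3)
      * (x1 ^+ 3 + y1 ^+ 3 + z1 ^+ 3 + m * (x1 * y1 * z1))).
    by rewrite /pvu; ring.
  by rewrite Fu Fv puv !(mul0r, mulr0) !addr0.
move=> x1 y1 z1 x2 y2 z2 Fu Fv puv pvu.
apply/row3_eqP; rewrite !(row3_0, row3_1, row3_2) !mxE; split.
- exact: key Fu Fv puv pvu.
- apply: (@key y1 z1 x1 y2 z2 x2).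
  + by rewrite -Fu; ring.
  + by rewrite -Fv; ring.
  + by rewrite -puv; ring.
  + by apply: contraNneq pvu => <-; apply/eqP; ring.
- apply: (@key z1 x1 y1 z2 x2 y2).
  + by rewrite -Fu; ring.
  + by rewrite -Fv; ring.
  + by rewrite -puv; ring.
  + by apply: contraNneq pvu => <-; apply/eqP; ring.
Qed.

Lemma vline_free u v (a b : K) : u != 0 -> v != 0 -> <[u]>%VS != <[v]>%VS ->
  a *: u = b *: v -> a = 0 /\ b = 0.
Proof.
move=> u0 v0 uv ab; have a0 : a = 0.
  apply/eqP; apply: contraNT uv => a0.
  have uE : u = (a^-1 * b) *: v by rewrite -scalerA -ab scalerK.
  rewrite uE vline_scale //; apply: contra_neq u0 => e; by rewrite uE e scale0r.
split=> //; apply/eqP; move/esym/eqP: ab.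
by rewrite a0 scale0r scaler_eq0 (negPf v0) orbF.
Qed.

Lemma hesse_secant_neq0 u v : u != 0 -> v != 0 -> <[u]>%VS != <[v]>%VS ->
  hesse_form m u = 0 -> hesse_form m v = 0 ->
  hesse_polar m v u *: u - hesse_polar m u v *: v != 0.
Proof.
move=> u0 v0 uv Fu Fv; rewrite subr_eq0; apply/eqP => /(vline_free u0 v0 uv)[pvu puv].
by have := hesse_no_line u0 v0 uv Fu Fv puv; rewrite pvu eqxx.
Qed.

Lemma on_hesse_third P Q : on_hesse m P -> on_hesse m Q ->
  on_hesse m (hesse_third m P Q).
Proof.
move=> /on_hesseP[u [u0 Fu ->]] /on_hesseP[v [v0 Fv ->]].
have [<-|uv] := eqVneq <[u]>%VS <[v]>%VS.
  rewrite hesse_third_tangent // on_hesse_line ?hesse_tangential_neq0 //.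
  by rewrite hesse_form_tangential Fu mulr0.
rewrite hesse_third_secant // on_hesse_line ?hesse_secant_neq0 //.
by rewrite -scaleNr hesse_formD Fu Fv; apply/eqP; ring.
Qed.

Lemma hesse_thirdC P Q : on_hesse m P -> on_hesse m Q ->
  hesse_third m P Q = hesse_third m Q P.
Proof.
move=> /on_hesseP[u [u0 Fu ->]] /on_hesseP[v [v0 Fv ->]].
have [<-//|uv] := eqVneq <[u]>%VS <[v]>%VS.
rewrite !hesse_third_secant // 1?eq_sym //.
rewrite -(@vline_scale _ (-1)) ?oppr_eq0 ?oner_eq0 //.
by rewrite scaleN1r opprB.
Qed.

Lemma hesse_polarr u : hesse_polar m u u = 3 * hesse_form m u.
Proof. by rewrite /hesse_polar /hesse_form; ring. Qed.

Lemma hesse_polarDr u v w (a b : K) :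
  hesse_polar m u (a *: v + b *: w) = a * hesse_polar m u v + b * hesse_polar m u w.
Proof. by rewrite /hesse_polar !mxE; ring. Qed.

Lemma hesse_polarDl u v (a b : K) :
  hesse_polar m (a *: u + b *: v) u = 3 * a ^+ 2 * hesse_form m u
    + 2 * a * b * hesse_polar m u v + b ^+ 2 * hesse_polar m v u.
Proof. by rewrite /hesse_polar /hesse_form !mxE; ring. Qed.

Lemma hesse_third_inv P Q : on_hesse m P -> on_hesse m Q ->
  hesse_third m P (hesse_third m P Q) = Q.
Proof.
move=> /on_hesseP[u [u0 Fu ->]] /on_hesseP[v [v0 Fv ->]].
have Ft : hesse_form m (hesse_tangential u) = 0.
  by rewrite hesse_form_tangential Fu mulr0.
have t0 := hesse_tangential_neq0 u0 Fu.
have [<-|uv] := eqVneq <[u]>%VS <[v]>%VS.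
  rewrite hesse_third_tangent //.
  have [ut|ut] := eqVneq <[u]>%VS <[hesse_tangential u]>%VS.
    by rewrite -ut hesse_third_tangent.
  rewrite hesse_third_secant // hesse_polar_tangential scale0r subr0 vline_scale //.
  by rewrite hesse_no_line ?hesse_polar_tangential.
rewrite hesse_third_secant //.
set w := _ - _; have w0 : w != 0 by rewrite hesse_secant_neq0.
have pvu_puv := hesse_no_line u0 v0 uv Fu Fv.
(* Here the line is tangent at [u]: the third point is [u] again, and [v] is its tangential
   point. *)
have [puv|puv] := eqVneq (hesse_polar m u v) 0.
  have -> : <[w]>%VS = <[u]>%VS.
    by rewrite /w puv scale0r subr0 vline_scale // pvu_puv.
  by rewrite hesse_third_tangent // (hesse_tangent_line u0 v0).
have uw : <[u]>%VS != <[w]>%VS.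
  apply/eqP => /esym/(vline_eqP w0)[k k0 wk].
  have /(vline_free u0 v0 uv)[_ /eqP] :
      (hesse_polar m v u - k) *: u = hesse_polar m u v *: v.
    by rewrite scalerBl -wk /w opprB addrC subrK.
  by rewrite (negPf puv).
rewrite hesse_third_secant //.
rewrite {1 2}/w -scaleNr hesse_polarDl hesse_polarDr hesse_polarr Fu.
(* The components along [u] cancel, which leaves this multiple of [v]. *)
rewrite -[RHS](@vline_scale _ (- hesse_polar m u v ^+ 3)) ?oppr_eq0 ?expf_neq0 //.
by congr (<[_]>%VS); rewrite /w; apply/row3_eqP; rewrite !mxE; split; ring.
Qed.

Lemma row3_011_neq0 : row3 0 (-1) 1 != 0 :> 'rV[K]_3.
Proof.
by apply/eqP => /row3_eqP[_ _]; rewrite row3_2 mxE => /eqP; rewrite oner_eq0.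
Qed.

Lemma on_hesse_zero : on_hesse m (hesse_zero K).
Proof.
rewrite on_hesse_line ?row3_011_neq0 // /hesse_form row3_0 row3_1 row3_2.
by apply/eqP; ring.
Qed.

Lemma hesse_third_zero : hesse_third m (hesse_zero K) (hesse_zero K) = hesse_zero K.
Proof.
rewrite hesse_third_tangent ?row3_011_neq0 //; congr (<[_]>%VS).
by apply/row3_eqP; rewrite /hesse_tangential !(row3_0, row3_1, row3_2); split; ring.
Qed.

(** * Addition, differences and flexes *)

Lemma on_hesse_add P Q : on_hesse m P -> on_hesse m Q -> on_hesse m (hesse_add m P Q).
Proof.
by move=> hP hQ; apply: on_hesse_third; [exact: on_hesse_zero | exact: on_hesse_third].
Qed.

Lemma on_hesse_opp P : on_hesse m P -> on_hesse m (hesse_opp m P).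
Proof.
by move=> hP; apply: on_hesse_third => //; exact: on_hesse_zero.
Qed.

Lemma on_hesse_muln P n : on_hesse m P -> on_hesse m (hesse_muln m P n).
Proof.
move=> hP; elim: n => [|n IH]; first exact: on_hesse_zero.
by rewrite /hesse_muln iterS; apply: on_hesse_add.
Qed.

Lemma on_hesse_mulz P n : on_hesse m P -> on_hesse m (hesse_mulz m P n).
Proof.
by move=> hP; case: n => n; [apply: on_hesse_muln | apply/on_hesse_opp/on_hesse_muln].
Qed.

(** The third point of P and -Q serves as the difference Q - P; both cancellations are instances of
    [hesse_third_inv]. *)
Lemma hesse_add_third P Q : on_hesse m P -> on_hesse m Q ->
  hesse_add m P (hesse_third m P (hesse_opp m Q)) = Q.
Proof.
move=> hP hQ; rewrite /hesse_add hesse_third_inv ?on_hesse_opp //.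
by rewrite /hesse_opp hesse_third_inv ?on_hesse_zero.
Qed.

(** At a flex P + P = -P, hence 3P = O. *)
Lemma flex_torsion P : on_hesse m P -> hesse_third m P P = P ->
  hesse_torsion m P.
Proof.
move=> hP PP; exists 3%N => //; have hO := on_hesse_zero.
rewrite /hesse_muln /= /hesse_add (hesse_thirdC hP hO) hesse_third_inv // PP.
by rewrite (hesse_thirdC hO hP) hesse_third_inv // hesse_third_zero.
Qed.

End HesseThird.

(** * The slope of a section and its additivity *)

Section SlopeRing.
Variables (D : idomainType) (A B : D) (theta : D -> D).
Hypothesis thetaD : {morph theta : x y / x + y}.
Hypothesis thetaM : forall x y, theta (x * y) = x * theta y + theta x * y.
Hypothesis thetaAB : theta A * B = A * theta B.
Hypothesis B0 : B != 0.

Definition cubic (x y z : D) := A * (x * y * z) + B * (x ^+ 3 + y ^+ 3 + z ^+ 3).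

Definition grad (x y z : D) := 3 * (B * x ^+ 2) + A * (y * z).

(* As [theta] fixes the cubic, (x, y, z) and its image under [theta] span the
   tangent line; [c] is the derivative of the elliptic logarithm along
   [theta]. *)
Definition slope (c x y z : D) :=
  [/\ y * theta z - z * theta y = c * grad x y z,
      z * theta x - x * theta z = c * grad y z x &
      x * theta y - y * theta x = c * grad z x y].

Let theta0 : theta 0 = 0.
Proof. by apply: (addrI (theta 0)); rewrite -thetaD !addr0. Qed.

Let thetaN x : theta (- x) = - theta x.
Proof. by apply/eqP; rewrite -addr_eq0 -thetaD addNr theta0. Qed.

Let thetaB x y : theta (x - y) = theta x - theta y.
Proof. by rewrite thetaD thetaN. Qed.

Let thetaX3 x : theta (x ^+ 3) = 3 * x ^+ 2 * theta x.
Proof. by rewrite !exprS expr0 mulr1 !thetaM; ring. Qed.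

Lemma cubic_rot x y z : cubic x y z = cubic y z x.
Proof. by rewrite /cubic; ring. Qed.

Lemma slope_rot c x y z : slope c x y z -> slope c y z x.
Proof. by case. Qed.

Lemma slopeZ c k x y z : k != 0 ->
  slope c (k * x) (k * y) (k * z) <-> slope c x y z.
Proof.
have wron a b : k * a * theta (k * b) - k * b * theta (k * a)
    = k ^+ 2 * (a * theta b - b * theta a) by rewrite !thetaM; ring.
have gradZ a b d : grad (k * a) (k * b) (k * d) = k ^+ 2 * grad a b d.
  by rewrite /grad; ring.
move=> k0; rewrite /slope !wron !gradZ !(mulrCA c).
have k20 : k ^+ 2 != 0 by rewrite expf_neq0.
by split=> -[h1 h2 h3]; split; rewrite ?h1 ?h2 ?h3 //; apply: (mulfI k20).
Qed.

Lemma slope_uniq c c' x y z :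
  [|| grad x y z != 0, grad y z x != 0 | grad z x y != 0] ->
  slope c x y z -> slope c' x y z -> c = c'.
Proof.
move=> g0 [h1 h2 h3] [k1 k2 k3].
by case/or3P: g0 => g; apply: (mulIf g); [rewrite -h1|rewrite -h2|rewrite -h3].
Qed.

(** Apply [theta] to the cubic equation: since [theta] kills [A / B], the derivatives of the
    coefficients contribute a multiple of the cubic itself. *)
Lemma grad_theta x y z : cubic x y z = 0 ->
  grad x y z * theta x + grad y z x * theta y + grad z x y * theta z = 0.
Proof.
move=> F0; apply: (mulfI B0); rewrite mulr0.
have F1 : theta A * (x * y * z) + A * (theta x * y * z + x * theta y * z + x * y * theta z)
    + theta B * (x ^+ 3 + y ^+ 3 + z ^+ 3)
    + B * (3 * x ^+ 2 * theta x + 3 * y ^+ 2 * theta y + 3 * z ^+ 2 * theta z) = 0.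
  by rewrite -[RHS]theta0 -F0 /cubic !(thetaD, thetaM, thetaX3); ring.
have eAB : theta A * B - A * theta B = 0 by rewrite thetaAB subrr.
transitivity (B * (theta A * (x * y * z)
    + A * (theta x * y * z + x * theta y * z + x * y * theta z)
    + theta B * (x ^+ 3 + y ^+ 3 + z ^+ 3)
    + B * (3 * x ^+ 2 * theta x + 3 * y ^+ 2 * theta y + 3 * z ^+ 2 * theta z))
  - theta B * cubic x y z - (theta A * B - A * theta B) * (x * y * z)).
  by rewrite /cubic /grad; ring.
by rewrite F1 F0 eAB; ring.
Qed.

Lemma grad_euler x y z : grad x y z * x + grad y z x * y + grad z x y * z = 3 * cubic x y z.
Proof. by rewrite /grad /cubic; ring. Qed.

(** The gradient is orthogonal to the point (Euler) and to its image under [theta], hence parallel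
    to their vector product. *)
Lemma slope_parallel x y z : cubic x y z = 0 ->
  (y * theta z - z * theta y) * grad y z x = (z * theta x - x * theta z) * grad x y z.
Proof.
move=> F0; apply/eqP; rewrite -subr_eq0; apply/eqP.
transitivity (theta z * (grad x y z * x + grad y z x * y + grad z x y * z)
   - z * (grad x y z * theta x + grad y z x * theta y + grad z x y * theta z)); first by ring.
by rewrite grad_theta // grad_euler F0 !mulr0 subr0.
Qed.

Let tangential_component c x y z : cubic x y z = 0 -> slope c x y z ->
  let: (X, Y, Z) := (x * (y ^+ 3 - z ^+ 3), y * (z ^+ 3 - x ^+ 3), z * (x ^+ 3 - y ^+ 3)) in
  Y * theta Z - Z * theta Y = - (2 * c) * grad X Y Z.
Proof.
move=> F0 [h1 h2 h3]; rewrite !(thetaM, thetaB, thetaX3).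
transitivity ((z ^+ 3 - x ^+ 3) * (x ^+ 3 - y ^+ 3) * (y * theta z - z * theta y)
   + 3 * (y * z) * ((y * z) ^+ 2 * (y * theta z - z * theta y)
      + (z * x) ^+ 2 * (z * theta x - x * theta z)
      + (x * y) ^+ 2 * (x * theta y - y * theta x))); first by ring.
rewrite h1 h2 h3 /grad; apply/eqP; rewrite -subr_eq0; apply/eqP.
transitivity (c * (3 * x ^+ 2 * (2 * y ^+ 3 + 2 * z ^+ 3 - x ^+ 3)) * cubic x y z).
  by rewrite /cubic; ring.
by rewrite F0 mulr0.
Qed.

(** The factor -2 reflects that the tangential point of P is -2P. *)
Lemma slope_tangential c x y z : cubic x y z = 0 -> slope c x y z ->
  slope (- (2 * c)) (x * (y ^+ 3 - z ^+ 3)) (y * (z ^+ 3 - x ^+ 3)) (z * (x ^+ 3 - y ^+ 3)).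
Proof.
move=> F0 h; split.
- exact: tangential_component F0 h.
- by apply: tangential_component (slope_rot h); rewrite -cubic_rot.
- by apply: tangential_component (slope_rot (slope_rot h)); rewrite cubic_rot.
Qed.

Definition polar x1 y1 z1 x2 y2 z2 :=
  grad x1 y1 z1 * x2 + grad y1 z1 x1 * y2 + grad z1 x1 y1 * z2.

Lemma cubic_secant x1 y1 z1 x2 y2 z2 :
  let a := polar x2 y2 z2 x1 y1 z1 in let b := polar x1 y1 z1 x2 y2 z2 in
  cubic x1 y1 z1 = 0 -> cubic x2 y2 z2 = 0 ->
  cubic (a * x1 - b * x2) (a * y1 - b * y2) (a * z1 - b * z2) = 0.
Proof.
move=> a b F1 F2.
transitivity (a ^+ 3 * cubic x1 y1 z1 - a ^+ 2 * b * polar x1 y1 z1 x2 y2 z2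
   + a * b ^+ 2 * polar x2 y2 z2 x1 y1 z1 - b ^+ 3 * cubic x2 y2 z2).
  by rewrite /cubic /polar /grad; ring.
by rewrite F1 F2 -/a -/b; ring.
Qed.

(* Both r x theta r and the gradient at r are orthogonal to r and theta r;
   their ratio is read off from the scalar products with the first point. *)
Lemma slope_secant c1 c2 x1 y1 z1 x2 y2 z2 :
  let a := polar x2 y2 z2 x1 y1 z1 in let b := polar x1 y1 z1 x2 y2 z2 in
  cubic x1 y1 z1 = 0 -> cubic x2 y2 z2 = 0 -> a != 0 -> b != 0 ->
  slope c1 x1 y1 z1 -> slope c2 x2 y2 z2 ->
  slope (- (c1 + c2)) (a * x1 - b * x2) (a * y1 - b * y2) (a * z1 - b * z2).
Proof.
move=> a b F1 F2 a0 b0 [h1 h2 h3] [k1 k2 k3].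
set x := a * x1 - _; set y := a * y1 - _; set z := a * z1 - _.
have F0 : cubic x y z = 0 by exact: cubic_secant.
have F0' : cubic y z x = 0 by rewrite -cubic_rot.
have p1 := slope_parallel F0; have p2 := slope_parallel F0'.
have F0'' : cubic z x y = 0 by rewrite cubic_rot.
have p3 := slope_parallel F0''.
have dotN : x1 * (y * theta z - z * theta y) + y1 * (z * theta x - x * theta z)
    + z1 * (x * theta y - y * theta x) = a * b ^+ 2 * (c1 + c2).
  rewrite /x /y /z !(thetaB, thetaM).
  transitivity (a * b * (x2 * (y1 * theta z1 - z1 * theta y1)
      + y2 * (z1 * theta x1 - x1 * theta z1) + z2 * (x1 * theta y1 - y1 * theta x1))
    + b ^+ 2 * (x1 * (y2 * theta z2 - z2 * theta y2)
      + y1 * (z2 * theta x2 - x2 * theta z2) + z1 * (x2 * theta y2 - y2 * theta x2))).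
    by ring.
  by rewrite h1 h2 h3 k1 k2 k3 /a /b /polar; ring.
have dotG : x1 * grad x y z + y1 * grad y z x + z1 * grad z x y = - (a * b ^+ 2).
  transitivity (3 * a ^+ 2 * cubic x1 y1 z1 - 2 * a * b * polar x1 y1 z1 x2 y2 z2
    + b ^+ 2 * polar x2 y2 z2 x1 y1 z1).
    by rewrite /x /y /z /cubic /polar /grad; ring.
  by rewrite F1 -/a -/b; ring.
have k0 : - (a * b ^+ 2) != 0 by rewrite oppr_eq0 mulf_neq0 ?expf_neq0.
rewrite /slope; move: p1 p2 p3 dotN dotG.
move: (y * theta z - z * theta y) (z * theta x - x * theta z) (x * theta y - y * theta x).
move=> N1 N2 N3.
move: (grad x y z) (grad y z x) (grad z x y) => G1 G2 G3 p1 p2 p3 dN dG.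
split; apply: (mulfI k0); rewrite -{1}dG.
- transitivity ((x1 * N1 + y1 * N2 + z1 * N3) * G1); last by rewrite dN; ring.
  transitivity (x1 * (N1 * G1) + y1 * (N1 * G2) + z1 * (N1 * G3)); first by ring.
  by rewrite p1 -p3; ring.
- transitivity ((x1 * N1 + y1 * N2 + z1 * N3) * G2); last by rewrite dN; ring.
  transitivity (x1 * (N2 * G1) + y1 * (N2 * G2) + z1 * (N2 * G3)); first by ring.
  by rewrite -p1 p2; ring.
- transitivity ((x1 * N1 + y1 * N2 + z1 * N3) * G3); last by rewrite dN; ring.
  transitivity (x1 * (N3 * G1) + y1 * (N3 * G2) + z1 * (N3 * G3)); first by ring.
  by rewrite p3 -p2; ring.
Qed.

End SlopeRing.

(** * The height form *)

Section HeightForm.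
Variable D : idomainType.
Variables (A B A' B' : D).

(* By [height_form_rot] the quotients of the three rotated forms by (y z)^2,
   (z x)^2 and (x y)^2 agree; as x, y, z are pairwise coprime, the common value
   is a polynomial. *)
Definition height_form (x y z x' y' z' : D) :=
  (A' * B - A * B') * (y * z) * (y * z' + z * y')
  + 3 * (B ^+ 2 * (z * x' - x * z') * (x * y' - y * x'))
  + A * B * (y * z' - z * y') ^+ 2.

Lemma height_form_rot x y z x' y' z' : cubic A B x y z = 0 ->
  A' * (x * y * z) + B' * (x ^+ 3 + y ^+ 3 + z ^+ 3) + grad A B x y z * x'
    + grad A B y z x * y' + grad A B z x y * z' = 0 ->
  x ^+ 2 * height_form x y z x' y' z' = y ^+ 2 * height_form y z x y' z' x'.
Proof.
move=> F0 F1; apply/eqP; rewrite -subr_eq0; apply/eqP.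
transitivity ((y * z * x' * B' + 3 * (y * x' * z' * B) - x * z * y' * B'
     - 3 * (x * y' * z' * B)) * cubic A B x y z
  + (x * z * y' * B - y * z * x' * B) *
   (A' * (x * y * z) + B' * (x ^+ 3 + y ^+ 3 + z ^+ 3) + grad A B x y z * x'
    + grad A B y z x * y' + grad A B z x y * z')).
  by rewrite /height_form /cubic /grad; ring.
by rewrite F0 F1 !mulr0 addr0.
Qed.

(** The quadratic part of [height_form] evaluated at the gradient instead of the vector product;
    this is how [c] enters the height equation. *)
Lemma grad_form x y z : cubic A B x y z = 0 ->
  3 * (B ^+ 2 * grad A B y z x * grad A B z x y) + A * B * grad A B x y z ^+ 2
    = B * (27 * B ^+ 3 + A ^+ 3) * (y * z) ^+ 2.
Proof.
move=> F0; apply/eqP; rewrite -subr_eq0; apply/eqP.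
transitivity (9 * (A * B ^+ 2 * x) * cubic A B x y z).
  by rewrite /cubic /grad; ring.
by rewrite F0 mulr0.
Qed.

(** Multiplying the three equations gives [(27 * B ^+ 3 + A ^+ 3) * (x * y * z) ^+ 2 = 0]; one zero
    coordinate then forces the others. *)
Lemma grad_smooth x y z : 3 != 0 :> D -> B != 0 -> 27 * B ^+ 3 + A ^+ 3 != 0 ->
  grad A B x y z = 0 -> grad A B y z x = 0 -> grad A B z x y = 0 ->
  [/\ x = 0, y = 0 & z = 0].
Proof.
move=> D3 B0 s0 g1 g2 g3.
have h1 : 3 * (B * x ^+ 2) = - (A * (y * z)) by apply/eqP; rewrite -addr_eq0 -/(grad _ _ _ _ _) g1.
have h2 : 3 * (B * y ^+ 2) = - (A * (z * x)) by apply/eqP; rewrite -addr_eq0 -/(grad _ _ _ _ _) g2.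
have h3 : 3 * (B * z ^+ 2) = - (A * (x * y)) by apply/eqP; rewrite -addr_eq0 -/(grad _ _ _ _ _) g3.
have n0 : x * y * z = 0.
  apply/eqP; have : (27 * B ^+ 3 + A ^+ 3) * (x * y * z) ^+ 2 = 0.
    transitivity ((3 * (B * x ^+ 2)) * (3 * (B * y ^+ 2)) * (3 * (B * z ^+ 2))
      + A ^+ 3 * (x * y * z) ^+ 2); first by ring.
    by rewrite h1 h2 h3; ring.
  by move=> /eqP; rewrite mulf_eq0 (negPf s0) expf_eq0.
have cancel a : 3 * (B * a ^+ 2) = 0 -> a = 0.
  by move=> /eqP; rewrite mulf_eq0 (negPf D3) mulf_eq0 (negPf B0) expf_eq0 => /eqP.
move/eqP: n0; rewrite !mulf_eq0 -orbA => /or3P[] /eqP e; rewrite e in h1 h2 h3 *.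
- by split=> //; apply: cancel; rewrite ?h2 ?h3; ring.
- by split=> //; apply: cancel; rewrite ?h1 ?h3; ring.
- by split=> //; apply: cancel; rewrite ?h1 ?h2; ring.
Qed.

End HeightForm.

(** * Leading coefficients *)

Section TopCoefficient.
Variable R : nzRingType.
Implicit Types p q : {poly R}.

(** The value at infinity of [p] taken as a form of degree [n]; [c] may be 0, so bounds add up
    without knowledge of exact degrees. *)
Definition top n p c := (size p <= n.+1)%N /\ p`_n = c.

Lemma topP n p : (size p <= n.+1)%N -> top n p p`_n. Proof. by []. Qed.

Lemma topC c : top 0 c%:P c.
Proof. by split; rewrite ?size_polyC_leq1 // coefC. Qed.

Lemma topXn n : top n 'X^n 1.
Proof. by split; rewrite ?size_polyXn // coefXn eqxx. Qed.

Lemma topS n p c : top n p c -> top n.+1 p 0.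
Proof. by case=> s _; split; [apply: leq_trans s _ | rewrite nth_default]. Qed.

Lemma topD n p q a b : top n p a -> top n q b -> top n (p + q) (a + b).
Proof.
move=> [sp pa] [sq qb]; split; last by rewrite coefD pa qb.
by apply: leq_trans (size_polyD _ _) _; rewrite geq_max sp.
Qed.

Lemma topN n p a : top n p a -> top n (- p) (- a).
Proof. by move=> [sp pa]; split; rewrite ?size_polyN ?coefN ?pa. Qed.

Lemma topB n p q a b : top n p a -> top n q b -> top n (p - q) (a - b).
Proof. by move=> hp /topN; exact: topD. Qed.

Lemma topM m n p q a b : top m p a -> top n q b -> top (m + n) (p * q) (a * b).
Proof.
move=> [sp <-] [sq <-]; split.
  apply: leq_trans (size_polyMleq _ _) _.
  by rewrite -subn1 leq_subLR; apply: leq_trans (leq_add sp sq) _; rewrite addSn addnS add1n.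
rewrite coefM (bigD1 (inord m)) //= inordK ?ltnS ?leq_addr // addKn big1 ?addr0 //.
move=> i im; have [lt_im|le_mi] := ltnP i m; last first.
  rewrite (nth_default 0 (s := p)) ?mul0r //; apply: leq_trans sp _.
  rewrite ltn_neqAle le_mi andbT; apply: contra im => /eqP mi.
  by apply/eqP/val_inj; rewrite /= inordK -?mi // ltnS leq_addr.
rewrite [q`_ _]nth_default ?mulr0 //; apply: leq_trans sq _.
by rewrite ltn_subRL addnC addnC ltn_add2r.
Qed.

(** The Euler operator keeps the bound [n], even for [n = 0]. *)
Lemma top_deriv n p a : top n p a -> top n ('X * p^`()) (n%:R * a).
Proof.
move=> [sp <-]; split; last first.
  by case: n {sp} => [|n]; rewrite coefXM ?mul0r // coef_deriv mulr_natl.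
apply/leq_sizeP => -[//|j] jn; rewrite coefXM /= coef_deriv nth_default ?mul0rn //.
by apply: leq_trans sp _.
Qed.

Lemma top_uniq n p a b : top n p a -> top n p b -> a = b.
Proof. by case=> _ <- [_ <-]. Qed.

End TopCoefficient.

(** If [p] attains its degree bound and [c * p] does not exceed it, [c] is constant. This is applied
    to the slope and to the height constant. *)
Lemma top_quotient (R : idomainType) n (c p : {poly R}) a b :
  top n p a -> a != 0 -> top n (c * p) b -> c = (c`_0)%:P.
Proof.
move=> [sp pa] a0 [scp _]; apply: size1_polyC.
have [->|c0] := eqVneq c 0; first by rewrite size_poly0.
have sp' : size p = n.+1.
  apply/eqP; rewrite eqn_leq sp ltnNge; apply/negP => /(nth_default 0) e.
  by move: a0; rewrite -pa e eqxx.
have p0 : p != 0 by rewrite -size_poly_gt0 sp'.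
by move: scp; rewrite size_mul // sp' addnS /= -addn1 addnC leq_add2l.
Qed.

(** * Coprime polynomial coordinates of points over the field of fractions *)

Lemma Bezout3 (F : closedFieldType) (p q r : {poly F}) :
  (forall t, ~~ [&& root p t, root q t & root r t]) ->
  exists a b c, a * p + b * q + c * r = 1.
Proof.
move=> nr; have cop : coprimep p (gcdp q r).
  apply: Pdiv.ClosedField.root_coprimep => t pt; apply: contra (nr t) => qrt.
  by rewrite pt -root_gcd.
have /Bezout_eq1_coprimepP[[a b] /= e] := cop.
have [[u v] /= /eqpf_eq[k k0 uv]] := Bezoutp q r.
have ge : gcdp q r = k^-1 *: (u * q + v * r) by rewrite uv scalerA mulVf // scale1r.
exists a, (b * (k^-1 *: u)), (b * (k^-1 *: v)).
by rewrite -e ge scalerDr mulrDr -!mulrA -!scalerAl addrA.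
Qed.

Lemma fraction_ratio (R : idomainType) (x : {fraction R}) :
  exists n d : R, d != 0 /\ x = tofrac n / tofrac d.
Proof.
elim/quotW: x => r; exists \n_r, \d_r; split; first exact: denom_ratioP.
have d0 : tofrac \d_r != 0 by rewrite tofrac_eq0 denom_ratioP.
apply: (mulIf d0); rewrite divfK //; unlock tofrac.
rewrite -[LHS]FracField.pi_mul; apply/eqmodP => /=.
by rewrite /FracField.mulf FracField.equivfE /= !numden_Ratio ?(oner_eq0, mulr1, denom_ratioP) // mulrC.
Qed.

Definition primitive (C : closedFieldType) (x y z : {poly C}) :=
  forall t, ~~ [&& root x t, root y t & root z t].

Lemma primitive_rot (C : closedFieldType) (x y z : {poly C}) :
  primitive x y z -> primitive y z x.
Proof. by move=> h t; apply: contra (h t) => /and3P[-> -> ->]. Qed.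

Lemma primitive_neq0 (C : closedFieldType) (x y z : {poly C}) :
  primitive x y z -> [|| x != 0, y != 0 | z != 0].
Proof.
move=> pr; apply/negPn; rewrite !negb_or !negbK; apply/negP => /and3P[/eqP x0 /eqP y0 /eqP z0].
by have := pr 0; rewrite x0 y0 z0 !root0.
Qed.

Lemma primitive_part (C : closedFieldType) (x y z : {poly C}) :
  [|| x != 0, y != 0 | z != 0] ->
  exists g x' y' z', [/\ g != 0, x = g * x', y = g * y', z = g * z' & primitive x' y' z'].
Proof.
move=> nz; pose g := gcdp x (gcdp y z).
have g0 : g != 0 by rewrite !gcdp_eq0 !negb_and.
have gx : g %| x by apply: dvdp_gcdl.
have gy : g %| y by apply: dvdp_trans (dvdp_gcdr _ _) (dvdp_gcdl _ _).
have gz : g %| z by apply: dvdp_trans (dvdp_gcdr _ _) (dvdp_gcdr _ _).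
exists g, (x %/ g), (y %/ g), (z %/ g); split; rewrite ?[g * _]mulrC ?divpK //.
move=> t; apply/negP; rewrite -!dvdp_XsubCl => /and3P[tx ty tz].
have : ('X - t%:P) * g %| g.
  by rewrite !dvdp_gcd -{1}(divpK gx) -{1}(divpK gy) -{1}(divpK gz) !dvdp_mul2r // tx ty.
by move=> /(dvdp_leq g0); rewrite size_monicM ?monicXsubC // size_XsubC ltnn.
Qed.

(** * Passage between the Hesse cubic over a field and its form with coefficients [A], [B] *)

Lemma hesse_smooth_ratio (F : fieldType) (a b : F) : b != 0 ->
  (a / b) ^+ 3 + 27 = (27 * b ^+ 3 + a ^+ 3) / b ^+ 3.
Proof. by move=> b0; field. Qed.

Lemma hesse_form_ratio (F : fieldType) (a b x y z : F) : b != 0 ->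
  b * hesse_form (a / b) (row3 x y z) = cubic a b x y z.
Proof.
by move=> b0; rewrite /hesse_form !(row3_0, row3_1, row3_2) /cubic; field.
Qed.

Lemma hesse_polar_ratio (F : fieldType) (a b x y z x' y' z' : F) : b != 0 ->
  b * hesse_polar (a / b) (row3 x y z) (row3 x' y' z') = polar a b x y z x' y' z'.
Proof.
by move=> b0; rewrite /hesse_polar !(row3_0, row3_1, row3_2) /polar /grad; field.
Qed.

Lemma cubic_morph (D D' : idomainType) (f : {rmorphism D -> D'}) a b x y z :
  f (cubic a b x y z) = cubic (f a) (f b) (f x) (f y) (f z).
Proof. by rewrite /cubic !(rmorphD, rmorphM, rmorphXn). Qed.

Lemma polar_morph (D D' : idomainType) (f : {rmorphism D -> D'}) a b x y z x' y' z' :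
  f (polar a b x y z x' y' z') = polar (f a) (f b) (f x) (f y) (f z) (f x') (f y') (f z').
Proof. by rewrite /polar /grad !(rmorphD, rmorphM, rmorphXn, rmorph_nat). Qed.

Lemma clear_denominators (F : fieldType) (v : 'rV[F]_3) n0 n1 n2 d0 d1 d2 :
  d0 != 0 -> d1 != 0 -> d2 != 0 ->
  v 0 0 = n0 / d0 -> v 0 1 = n1 / d1 -> v 0 2 = n2 / d2 ->
  row3 (n0 * d1 * d2) (n1 * d0 * d2) (n2 * d0 * d1) = (d0 * d1 * d2) *: v.
Proof.
move=> d00 d10 d20 e0 e1 e2; apply/row3_eqP.
rewrite !(row3_0, row3_1, row3_2) !mxE e0 e1 e2.
by split; field; rewrite ?d00 ?d10 ?d20.
Qed.

Lemma disc_morph (D D' : idomainType) (f : {rmorphism D -> D'}) a b :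
  f (27 * b ^+ 3 + a ^+ 3) = 27 * f b ^+ 3 + f a ^+ 3.
Proof. by rewrite rmorphD rmorphM !rmorphXn rmorph_nat. Qed.

Definition deg3 (R : nzRingType) (x y z : {poly R}) :=
  (maxn (maxn (size x) (size y)) (size z)).-1.

Lemma top_deg3 (R : nzRingType) (x y z : {poly R}) : [|| x != 0, y != 0 | z != 0] ->
  [/\ top (deg3 x y z) x x`_(deg3 x y z), top (deg3 x y z) y y`_(deg3 x y z),
      top (deg3 x y z) z z`_(deg3 x y z) &
   ~ [/\ x`_(deg3 x y z) = 0, y`_(deg3 x y z) = 0 & z`_(deg3 x y z) = 0]].
Proof.
move=> nz; set d := deg3 x y z.
have sd : (maxn (maxn (size x) (size y)) (size z) = d.+1)%N.
  by rewrite /d /deg3 prednK // !leq_max !size_poly_gt0 -orbA.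
have sx : (size x <= d.+1)%N by rewrite -sd !leq_max leqnn.
have sy : (size y <= d.+1)%N by rewrite -sd !leq_max leqnn orbT.
have sz : (size z <= d.+1)%N by rewrite -sd leq_max leqnn orbT.
split=> //; case=> x0 y0 z0.
have drop (p : {poly R}) : (size p <= d.+1)%N -> p`_d = 0 -> (size p <= d)%N.
  move=> sp p0; apply/leq_sizeP => j; rewrite leq_eqVlt => /orP[/eqP<-//|dj].
  by rewrite nth_default // (leq_trans sp).
have : (d.+1 <= d)%N by rewrite -sd !geq_max !drop.
by rewrite ltnn.
Qed.

Lemma horner_cubic (F : idomainType) (A B x y z : {poly F}) t :
  (cubic A B x y z).[t] = cubic A.[t] B.[t] x.[t] y.[t] z.[t].
Proof. by rewrite /cubic !(hornerD, horner_exp, hornerM). Qed.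

Lemma horner_grad (F : idomainType) (A B x y z : {poly F}) t :
  (grad A B x y z).[t] = grad A.[t] B.[t] x.[t] y.[t] z.[t].
Proof. by rewrite /grad !mulr_natl !(hornerD, hornerMn, horner_exp, hornerM). Qed.

Lemma cubic_deriv (F : idomainType) (A B x y z : {poly F}) : cubic A B x y z = 0 ->
  A^`() * (x * y * z) + B^`() * (x ^+ 3 + y ^+ 3 + z ^+ 3) + grad A B x y z * x^`()
    + grad A B y z x * y^`() + grad A B z x y * z^`() = 0.
Proof.
move=> F0; have := congr1 (@deriv F) F0; rewrite deriv0 => F1; rewrite -[RHS]F1.
by rewrite /cubic /grad !exprS !expr0 !derivE; ring.
Qed.

Lemma horner_cubic_deriv (F : idomainType) (A B x y z : {poly F}) t :
  cubic A B x y z = 0 ->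
  A^`().[t] * (x.[t] * y.[t] * z.[t]) + B^`().[t] * (x.[t] ^+ 3 + y.[t] ^+ 3 + z.[t] ^+ 3)
    + grad A.[t] B.[t] x.[t] y.[t] z.[t] * x^`().[t]
    + grad A.[t] B.[t] y.[t] z.[t] x.[t] * y^`().[t]
    + grad A.[t] B.[t] z.[t] x.[t] y.[t] * z^`().[t] = 0.
Proof.
move=> /cubic_deriv /(congr1 (horner^~ t)); rewrite horner0 => <-.
by rewrite -!horner_grad !(hornerD, horner_exp, hornerM).
Qed.

Lemma horner_cross (F : idomainType) (p q p' q' : {poly F}) t :
  (p' * q - p * q').[t] = p'.[t] * q.[t] - p.[t] * q'.[t].
Proof. by rewrite hornerD hornerN !hornerM. Qed.

(** * Slope and height of a section given by primitive polynomials *)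

Section SlopePoly.
Variables (C : numClosedFieldType) (delta : C -> C).
Hypothesis deltaD : {morph delta : x y / x + y}.
Hypothesis deltaM : forall x y, delta (x * y) = x * delta y + delta x * y.
Variables a0 a2 b0 b2 : C.

Let A : {poly C} := a2%:P * 'X^2 + a0%:P.
Let B : {poly C} := b2%:P * 'X^2 + b0%:P.
(** The data of [theta] at the two ramification points: below, [U = u t], [W] has value [w0] at 0
    and coefficient [w4] at t^4. *)
Let u := 2 * (a2 * b0 - a0 * b2).
Let w0 := delta a0 * b0 - a0 * delta b0.
Let w4 := delta a2 * b2 - a2 * delta b2.

Hypothesis u_neq0 : u != 0.
Hypothesis b0_neq0 : b0 != 0.
Hypothesis b2_neq0 : b2 != 0.
Hypothesis smooth0 : 27 * b0 ^+ 3 + a0 ^+ 3 != 0.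
Hypothesis smooth2 : 27 * b2 ^+ 3 + a2 ^+ 3 != 0.

Let delta0 : delta 0 = 0.
Proof. by apply: (addrI (delta 0)); rewrite -deltaD !addr0. Qed.

Definition coef_deriv_poly (p : {poly C}) := map_poly delta p.
Local Notation dpoly := coef_deriv_poly.

Lemma coef_dpoly p i : (dpoly p)`_i = delta p`_i.
Proof. by rewrite coef_map_id0. Qed.

Lemma dpolyD : {morph dpoly : p q / p + q}.
Proof. by move=> p q; apply/polyP => i; rewrite coefD !coef_dpoly coefD deltaD. Qed.

Lemma dpolyM p q : dpoly (p * q) = p * dpoly q + dpoly p * q.
Proof.
apply/polyP => i; rewrite coefD !coefM coef_dpoly coefM.
rewrite (big_morph delta deltaD delta0) -big_split /=; apply: eq_bigr => j _.
by rewrite deltaM !coef_dpoly.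
Qed.

Lemma top_dpoly n p a : top n p a -> top n (dpoly p) (delta a).
Proof.
move=> [sp <-]; split; rewrite ?coef_dpoly //; apply/leq_sizeP => j jn.
by rewrite coef_dpoly nth_default // (leq_trans sp).
Qed.

Let U := A^`() * B - A * B^`().
Let W := dpoly A * B - A * dpoly B.

(** [U] and [W] are [B ^+ 2] times the derivatives of [A / B] along d/dt and [delta], so the two
    contributions to the derivative of [A / B] cancel. *)
Definition transport (p : {poly C}) := U * dpoly p - W * p^`().
Local Notation theta := transport.

Lemma transportD : {morph theta : p q / p + q}.
Proof. by move=> p q; rewrite /theta dpolyD derivD; ring. Qed.

Lemma transportM p q : theta (p * q) = p * theta q + theta p * q.
Proof. by rewrite /theta dpolyM derivM; ring. Qed.

Lemma transportAB : theta A * B = A * theta B.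
Proof. by rewrite /theta /U /W; ring. Qed.

Let UE : U = u%:P * 'X.
Proof.
rewrite /U /A /B /u !derivE !(polyCM, polyCB) /=.
by rewrite (_ : 2%:P = 2 :> {poly C}) ?rmorph_nat //; ring.
Qed.

Let top_U : top 1 U u.
Proof. by rewrite UE; have := topM (topC u) (topXn C 1); rewrite mulr1. Qed.

Let top_A : top 2 A a2.
Proof.
have := topD (topM (topC a2) (topXn C 2)) (topS (topS (topC a0))).
by rewrite mulr1 addr0.
Qed.

Let top_B : top 2 B b2.
Proof.
have := topD (topM (topC b2) (topXn C 2)) (topS (topS (topC b0))).
by rewrite mulr1 addr0.
Qed.

Let top_W : top 4 W w4.
Proof. by apply: topB; apply: (topM (m := 2) (n := 2)) => //; apply: top_dpoly. Qed.

Let A_0 : A.[0] = a0. Proof. by rewrite /A !(hornerD, hornerM, hornerC, hornerX) !mulr0 add0r. Qed.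
Let B_0 : B.[0] = b0. Proof. by rewrite /B !(hornerD, hornerM, hornerC, hornerX) !mulr0 add0r. Qed.

Lemma quad_neq0 : B != 0.
Proof. by apply: contra_neq b0_neq0 => B0; rewrite -B_0 B0 horner0. Qed.

Let W_0 : W.[0] = w0.
Proof.
have d0 p : (dpoly p).[0] = delta p.[0] by rewrite !horner_coef0 coef_dpoly.
by rewrite horner_cross !d0 A_0 B_0.
Qed.

(* A common zero of two coordinates would be a node of a triangle [B = 0]; the
   total space is smooth there, so no section passes through it. *)
Lemma no_common_root2 x y z t : cubic A B x y z = 0 -> primitive x y z ->
  x.[t] = 0 -> y.[t] <> 0.
Proof.
move=> F0 pr xt yt.
have zt : z.[t] ^+ 3 != 0.
  by rewrite expf_neq0 //; apply: contraNneq (pr t) => zt; rewrite /root xt yt zt eqxx.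
have Bt : B.[t] = 0.
  have := horner_cubic A B x y z t; rewrite F0 horner0 /cubic xt yt => h.
  by apply: (mulIf zt); rewrite mul0r [RHS]h; ring.
have Bt' : B^`().[t] = 0.
  have := horner_cubic_deriv t F0; rewrite xt yt Bt /grad => h.
  by apply: (mulIf zt); rewrite mul0r -[RHS]h; ring.
have B't : B^`().[t] = b2 * t *+ 2.
  rewrite /B derivD derivM !derivC derivXn mul0r add0r addr0.
  by rewrite hornerM hornerC hornerMn hornerX mulrnAr.
move/eqP: Bt'; rewrite B't mulrn_eq0 mulf_eq0 (negPf b2_neq0) /= => /eqP t0.
by move/eqP: Bt; rewrite t0 B_0 (negPf b0_neq0).
Qed.

(** At [t = 0] the fibre is smooth. At another common zero, the cubic equation and its t-derivative
    are linear equations in xyz and x^3 + y^3 + z^3 with determinant [U], nonzero there; so the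
    point is a base point of the Hesse pencil, where every member is smooth. *)
Lemma grad_no_common_root x y z : cubic A B x y z = 0 -> primitive x y z ->
  forall t, ~~ [&& root (grad A B x y z) t, root (grad A B y z x) t
                 & root (grad A B z x y) t].
Proof.
move=> F0 pr t; apply/negP; rewrite /root !horner_grad => /and3P[/eqP g1 /eqP g2 /eqP g3].
have C3 : 3 != 0 :> C by rewrite pnatr_eq0.
have nz : ~ [/\ x.[t] = 0, y.[t] = 0 & z.[t] = 0].
  by case=> xt yt zt; have := pr t; rewrite /root xt yt zt eqxx.
have [t0|t0] := eqVneq t 0.
  move: g1 g2 g3; rewrite t0 in nz *; rewrite A_0 B_0 => g1 g2 g3.
  exact/nz/(grad_smooth C3 b0_neq0 smooth0 g1 g2 g3).
have := horner_cubic_deriv t F0; have := horner_cubic A B x y z t.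
rewrite g1 g2 g3 F0 horner0 /cubic => /esym e1 e2.
have Ut : A^`().[t] * B.[t] - A.[t] * B^`().[t] != 0.
  by rewrite -horner_cross -/U UE hornerM hornerC hornerX mulf_neq0.
have n0 : x.[t] * y.[t] * z.[t] = 0.
  apply: (mulfI Ut); rewrite mulr0.
  transitivity (B.[t] * (A^`().[t] * (x.[t] * y.[t] * z.[t])
     + B^`().[t] * (x.[t] ^+ 3 + y.[t] ^+ 3 + z.[t] ^+ 3)
     + 0 * x^`().[t] + 0 * y^`().[t] + 0 * z^`().[t])
   - B^`().[t] * (A.[t] * (x.[t] * y.[t] * z.[t])
     + B.[t] * (x.[t] ^+ 3 + y.[t] ^+ 3 + z.[t] ^+ 3))); first by ring.
  by rewrite e1 e2 !mulr0 subr0.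
have s0 : x.[t] ^+ 3 + y.[t] ^+ 3 + z.[t] ^+ 3 = 0.
  apply: (mulfI Ut); rewrite mulr0.
  transitivity (A^`().[t] * (A.[t] * (x.[t] * y.[t] * z.[t])
     + B.[t] * (x.[t] ^+ 3 + y.[t] ^+ 3 + z.[t] ^+ 3))
   - A.[t] * (A^`().[t] * (x.[t] * y.[t] * z.[t])
     + B^`().[t] * (x.[t] ^+ 3 + y.[t] ^+ 3 + z.[t] ^+ 3)
     + 0 * x^`().[t] + 0 * y^`().[t] + 0 * z^`().[t])); first by ring.
  by rewrite e1 e2 !mulr0 subr0.
have AB0 : (A.[t] != 0) || (B.[t] != 0).
  by apply: contraNT Ut; rewrite negb_or !negbK => /andP[/eqP-> /eqP->]; rewrite mulr0 mul0r subrr.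
apply: nz; move: g1 g2 g3 n0 s0 AB0; rewrite /grad; clear F0 pr.
move: x.[t] y.[t] z.[t] A.[t] B.[t] => X Y Z a b.
have key (p q r : C) : p = 0 -> a * (q * r) = 0 -> 3 * (b * q ^+ 2) = 0 ->
    3 * (b * r ^+ 2) = 0 -> p ^+ 3 + q ^+ 3 + r ^+ 3 = 0 -> (a != 0) || (b != 0) ->
    q = 0 /\ r = 0.
  move=> -> /eqP h1 /eqP h2 /eqP h3 h4 ab; move: h1 h2 h3.
  rewrite !(mulf_eq0 3) !(mulf_eq0 b) !(mulf_eq0 a) (negPf C3) !expf_eq0 /=.
  have [b00|b00] := eqVneq b 0; last by move=> _ /eqP -> /eqP ->.
  move: ab; rewrite b00 eqxx orbF => /negPf -> /=; rewrite mulf_eq0 => qr _ _.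
  move: h4; rewrite expr0n add0r.
  case/orP: qr => /eqP ->; rewrite expr0n ?add0r ?addr0 => /eqP; rewrite expf_eq0 => /eqP ->;
    by split.
move=> g1 g2 g3 /eqP; rewrite !mulf_eq0 -orbA => /or3P[] /eqP e s0 ab.
- have [|||||-> ->//] := key X Y Z e; rewrite ?s0 //.
  + by rewrite -g1 e; ring.
  + by rewrite -g2 e; ring.
  + by rewrite -g3 e; ring.
- have [|||||-> ->//] := key Y Z X e; rewrite ?s0 //.
  + by rewrite -g2 e; ring.
  + by rewrite -g3 e; ring.
  + by rewrite -g1 e; ring.
  + by rewrite -s0; ring.
- have [|||||-> ->//] := key Z X Y e; rewrite ?s0 //.
  + by rewrite -g3 e; ring.
  + by rewrite -g1 e; ring.
  + by rewrite -g2 e; ring.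
  + by rewrite -s0; ring.
Qed.

Let kappa0 := b0 * (27 * b0 ^+ 3 + a0 ^+ 3).
Let kappa2 := b2 * (27 * b2 ^+ 3 + a2 ^+ 3).

Let top_grad d x y z xd yd zd : top d x xd -> top d y yd -> top d z zd ->
  top (2 + (d + d)) (grad A B x y z) (grad a2 b2 xd yd zd).
Proof.
move=> hx hy hz; rewrite /grad !expr2; apply: topD; last first.
  by apply: (topM top_A); apply: topM.
have -> : 3 = 3%:P :> {poly C} by rewrite rmorph_nat.
apply: (topM (topC _)).
by apply: (topM top_B); apply: topM.
Qed.

Let top_cubic d x y z xd yd zd : top d x xd -> top d y yd -> top d z zd ->
  cubic A B x y z = 0 -> cubic a2 b2 xd yd zd = 0.
Proof.
move=> hx hy hz F0.
have h : top (2 + (d + d + d)) (cubic A B x y z) (cubic a2 b2 xd yd zd).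
  have cube (T : comNzRingType) (v : T) : v ^+ 3 = v * v * v by ring.
  rewrite /cubic !cube; apply: topD.
    exact: topM top_A (topM (topM hx hy) hz).
  by apply: (topM top_B (topD (topD _ _) _)); apply: topM => //; apply: topM.
by case: h => _; rewrite F0 coef0.
Qed.

(* The leading terms of y * z' and z * y' cancel; the factor 'X^2 avoids the
   truncated subtraction in the degree bound 2 d - 2. *)
Let top_wronskian d (y z : {poly C}) yd zd : top d y yd -> top d z zd ->
  exists p, top (d + d) ('X^2 * (y * z^`() - z * y^`())) p.
Proof.
move=> hy hz; have := topB (topM hy (top_deriv hz)) (topM hz (top_deriv hy)).
have -> : yd * (d%:R * zd) - zd * (d%:R * yd) = 0 by ring.
set q := _ - _ => -[sq cq]; exists ('X^2 * (y * z^`() - z * y^`()))`_(d + d); apply: topP.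
have -> : 'X^2 * (y * z^`() - z * y^`()) = 'X * q by rewrite /q; ring.
apply/leq_sizeP => -[//|j] jd; rewrite coefXM /=.
move: jd; rewrite ltnS leq_eqVlt => /orP[/eqP<-//|jd].
by rewrite nth_default // (leq_trans sq).
Qed.

(** At infinity the [delta] part drops out: as [U] has degree 1, its degree is at most
    [3 + (d + d)], one below the bound. *)
Let top_slope_component d (y z : {poly C}) yd zd p : top d y yd -> top d z zd ->
  top (d + d) ('X^2 * (y * z^`() - z * y^`())) p ->
  top (4 + (d + d)) ('X^2 * (y * theta z - z * theta y)) (- (w4 * p)).
Proof.
move=> hy hz hp; rewrite -[- (w4 * p)]sub0r.
have -> : 'X^2 * (y * theta z - z * theta y)
    = U * ('X^2 * (y * dpoly z - z * dpoly y)) - W * ('X^2 * (y * z^`() - z * y^`())).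
  by rewrite /transport; ring.
apply: topB; last exact: (topM top_W).
apply: topS; apply: (topM top_U (topM (topXn _ 2) _)).
exact: topB (topM hy (top_dpoly hz)) (topM hz (top_dpoly hy)).
Qed.

Let slope_component0 (y z : {poly C}) :
  (y * theta z - z * theta y).[0] = - (w0 * (y.[0] * z^`().[0] - z.[0] * y^`().[0])).
Proof.
have -> : y * theta z - z * theta y
    = U * (y * dpoly z - z * dpoly y) - W * (y * z^`() - z * y^`()).
  by rewrite /transport; ring.
rewrite UE -mulrA hornerD hornerN (hornerM W) W_0 !hornerM hornerX mul0r mulr0 sub0r.
by rewrite hornerD hornerN !hornerM.
Qed.

Lemma slope_exists d x y z xd yd zd :
  cubic A B x y z = 0 -> primitive x y z ->
  top d x xd -> top d y yd -> top d z zd -> ~ [/\ xd = 0, yd = 0 & zd = 0] ->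
  exists c : C, slope A B theta c%:P x y z.
Proof.
move=> F0 pr hx hy hz nz.
have [al [be [ga bez]]] := Bezout3 (grad_no_common_root F0 pr).
have F0' : cubic A B y z x = 0 by rewrite -cubic_rot.
have F0'' : cubic A B z x y = 0 by rewrite cubic_rot.
have p1 := slope_parallel transportD transportM transportAB quad_neq0 F0.
have p2 := slope_parallel transportD transportM transportAB quad_neq0 F0'.
have p3 := slope_parallel transportD transportM transportAB quad_neq0 F0''.
have [p hp] := top_wronskian hy hz.
have [q hq] := top_wronskian hz hx.
have [r hr] := top_wronskian hx hy.
have h1 := top_slope_component hy hz hp.
have h2 := top_slope_component hz hx hq.
have h3 := top_slope_component hx hy hr.
have g1 := topM (topXn C 2) (top_grad hx hy hz).
have g2 := topM (topXn C 2) (top_grad hy hz hx).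
have g3 := topM (topXn C 2) (top_grad hz hx hy).
rewrite !mul1r in g1 g2 g3.
(* The ratio of the two parallel vectors, a polynomial thanks to the Bezout coefficients. *)
pose c := al * (y * theta z - z * theta y) + be * (z * theta x - x * theta z)
  + ga * (x * theta y - y * theta x).
have hc : slope A B theta c x y z.
  rewrite /slope /c; move: p1 p2 p3 bez {h1 h2 h3 g1 g2 g3}.
  move: (y * theta z - z * theta y) (z * theta x - x * theta z) (x * theta y - y * theta x).
  move=> N1 N2 N3; move: (grad A B x y z) (grad A B y z x) (grad A B z x y).
  move=> G1 G2 G3 p1 p2 p3 bez; split.
  - transitivity (al * (N1 * G1) + be * (N2 * G1) + ga * (N3 * G1)); last by ring.
    by rewrite p3 -p1 -[LHS]mulr1 -bez; ring.
  - transitivity (al * (N1 * G2) + be * (N2 * G2) + ga * (N3 * G2)); last by ring.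
    by rewrite p1 -p2 -[LHS]mulr1 -bez; ring.
  - transitivity (al * (N1 * G3) + be * (N2 * G3) + ga * (N3 * G3)); last by ring.
    by rewrite -p3 p2 -[LHS]mulr1 -bez; ring.
exists c`_0; suff <- : c = (c`_0)%:P by [].
have [e1 e2 e3] := hc.
rewrite e1 mulrCA in h1; rewrite e2 mulrCA in h2; rewrite e3 mulrCA in h3.
(* The fibre at infinity is smooth, so some component of the gradient attains its degree bound. *)
have [G1|G1] := eqVneq (grad a2 b2 xd yd zd) 0; last exact: top_quotient g1 G1 h1.
have [G2|G2] := eqVneq (grad a2 b2 yd zd xd) 0; last exact: top_quotient g2 G2 h2.
have [G3|G3] := eqVneq (grad a2 b2 zd xd yd) 0; last exact: top_quotient g3 G3 h3.
by case: nz; apply: grad_smooth G1 G2 G3 => //; rewrite pnatr_eq0.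
Qed.

(** The degree becomes a coefficient here: the first term of [height_form] contains (y z)(y z)', and
    y z has formal degree 2d. *)
Let top_height d x y z yd zd p q r : top d y yd -> top d z zd ->
  top (d + d) ('X^2 * (y * z^`() - z * y^`())) p ->
  top (d + d) ('X^2 * (z * x^`() - x * z^`())) q ->
  top (d + d) ('X^2 * (x * y^`() - y * x^`())) r ->
  top (4 + (d + d) + (d + d)) ('X^4 * height_form A B A^`() B^`() x y z x^`() y^`() z^`())
    (2 * d%:R * u * (yd * zd) ^+ 2 + 3 * (b2 ^+ 2 * q * r) + a2 * b2 * p ^+ 2).
Proof.
move=> hy hz hp hq hr; have hyz := topM hy hz.
have h1 := topM top_U (topM (topXn C 3) (topM hyz (top_deriv hyz))).
have h2 := topM (topC 3) (topM (topM (topM top_B top_B) hq) hr).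
have h3 := topM (topM top_A top_B) (topM hp hp).
have := topD (topD h1 h2) h3; congr top; last by rewrite natrD; ring.
by rewrite derivM /height_form -/U (_ : 3%:P = 3 :> {poly C}) ?rmorph_nat //; ring.
Qed.

Let height_form0 (x y z : {poly C}) :
  (height_form A B A^`() B^`() x y z x^`() y^`() z^`()).[0]
  = 3 * (b0 ^+ 2 * (z.[0] * x^`().[0] - x.[0] * z^`().[0])
               * (x.[0] * y^`().[0] - y.[0] * x^`().[0]))
    + a0 * b0 * (y.[0] * z^`().[0] - z.[0] * y^`().[0]) ^+ 2.
Proof.
rewrite /height_form -/U UE -A_0 -B_0 -!horner_cross.
have -> : 3 = 3%:P :> {poly C} by rewrite rmorph_nat.
have h (e f g k : {poly C}) : (u%:P * 'X * e * f + 3%:P * g + k).[0] = 3 * g.[0] + k.[0].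
  by rewrite !hornerD !hornerM hornerX !hornerC mulr0 !mul0r add0r.
by rewrite h !hornerM ?horner_exp.
Qed.

Lemma two_nonzero (a b x y z : C) : b != 0 -> cubic a b x y z = 0 ->
  ~ [/\ x = 0, y = 0 & z = 0] -> [|| y * z != 0, z * x != 0 | x * y != 0].
Proof.
move=> b00 F0 nz; apply/negPn; rewrite !negb_or !negbK; apply/negP => /and3P[yz zx xy].
have key p q r : p = 0 -> q * r == 0 -> b * (p ^+ 3 + q ^+ 3 + r ^+ 3) = 0 -> q = 0 /\ r = 0.
  move=> -> /eqP qr /eqP; rewrite mulf_eq0 (negPf b00) expr0n add0r /= => /eqP.
  move/eqP: qr; rewrite mulf_eq0 => /orP[] /eqP ->;
    by rewrite expr0n /= ?add0r ?addr0 => /eqP; rewrite expf_eq0 => /eqP ->.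
have s0 : b * (x ^+ 3 + y ^+ 3 + z ^+ 3) = 0.
  by rewrite -[RHS]F0 /cubic (eqP xy); ring.
apply: nz; move: (xy); rewrite mulf_eq0 => /orP[] /eqP e.
  by have [-> ->] := key _ _ _ e yz s0.
have s0' : b * (y ^+ 3 + z ^+ 3 + x ^+ 3) = 0 by rewrite -s0; ring.
by have [-> ->] := key _ _ _ e zx s0'.
Qed.

Lemma slope_height d x y z xd yd zd c :
  cubic A B x y z = 0 -> primitive x y z ->
  top d x xd -> top d y yd -> top d z zd -> ~ [/\ xd = 0, yd = 0 & zd = 0] ->
  slope A B theta c%:P x y z ->
  2 * d%:R * u * (w0 ^+ 2 * w4 ^+ 2) = c ^+ 2 * (w4 ^+ 2 * kappa0 - w0 ^+ 2 * kappa2).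
Proof.
move=> F0 pr hx hy hz nz hc.
have F0' : cubic A B y z x = 0 by rewrite -cubic_rot.
have F0'' : cubic A B z x y = 0 by rewrite cubic_rot.
have [p hp] := top_wronskian hy hz.
have [q hq] := top_wronskian hz hx.
have [r hr] := top_wronskian hx hy.
have [c1 c2 c3] := hc.
have slope_top (a b : {poly C}) ad bd s G g : top d a ad -> top d b bd ->
    top (d + d) ('X^2 * (a * b^`() - b * a^`())) s -> top (2 + (d + d)) G g ->
    a * theta b - b * theta a = c%:P * G -> w4 * s = - (c * g).
  move=> ha hb hs hG e; have := top_slope_component ha hb hs.
  rewrite e mulrCA => h; have := topM (topC c) (topM (topXn C 2) hG).
  by rewrite mul1r => /(top_uniq h) <-; rewrite opprK.
have tp := slope_top _ _ _ _ _ _ _ hy hz hp (top_grad hx hy hz) c1.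
have tq := slope_top _ _ _ _ _ _ _ hz hx hq (top_grad hy hz hx) c2.
have tr := slope_top _ _ _ _ _ _ _ hx hy hr (top_grad hz hx hy) c3.
have slope_zero (a b G : {poly C}) : a * theta b - b * theta a = c%:P * G ->
    w0 * (a.[0] * b^`().[0] - b.[0] * a^`().[0]) = - (c * G.[0]).
  move=> /(congr1 (horner^~ 0)); rewrite slope_component0 hornerM hornerC => <-.
  by rewrite opprK.
have zp := slope_zero _ _ _ c1; have zq := slope_zero _ _ _ c2; have zr := slope_zero _ _ _ c3.
rewrite !horner_grad A_0 B_0 in zp zq zr.
have H1 := top_height hy hz hp hq hr.
have H2 := top_height hz hx hq hr hp.
have H3 := top_height hx hy hr hp hq.
have Z1 := height_form0 x y z; have Z2 := height_form0 y z x; have Z3 := height_form0 z x y.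
have := height_form_rot F0'' (cubic_deriv F0'').
have := height_form_rot F0' (cubic_deriv F0').
have := height_form_rot F0 (cubic_deriv F0).
move: H1 H2 H3 Z1 Z2 Z3.
set Hx := height_form _ _ _ _ x _ _ _ _ _; set Hy := height_form _ _ _ _ y _ _ _ _ _.
set Hz := height_form _ _ _ _ z _ _ _ _ _.
move=> H1 H2 H3 Z1 Z2 Z3 R1 R2 R3.
(* A common zero of the three products would make two coordinates vanish together, which
   [no_common_root2] excludes. *)
have [al [be [ga bez]]] : exists al be ga,
    al * (y * z) ^+ 2 + be * (z * x) ^+ 2 + ga * (x * y) ^+ 2 = 1.
  apply: Bezout3 => t; rewrite /root !horner_exp !hornerM !expf_eq0 /= !mulf_eq0.
  apply/negP => /and3P[yz zx xy].
  have n1 := no_common_root2 (t := t) F0 pr.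
  have n2 := no_common_root2 (t := t) F0' (primitive_rot pr).
  have n3 := no_common_root2 (t := t) F0'' (primitive_rot (primitive_rot pr)).
  case/orP: yz => /eqP e1; case/orP: zx => /eqP e2; case/orP: xy => /eqP e3; by
    first [exact: (n1 e3) | exact: n1 | exact: n2 | exact: n3].
(* The common quotient of the three rotated height forms. *)
pose e := al * Hx + be * Hy + ga * Hz.
have E1 : e * (y * z) ^+ 2 = Hx.
  transitivity (al * (Hx * (y * z) ^+ 2) + be * (z ^+ 2 * (y ^+ 2 * Hy))
    + ga * (y ^+ 2 * (z ^+ 2 * Hz))); first by rewrite /e; ring.
  by rewrite -R1 R3 -[RHS]mulr1 -bez; ring.
have E2 : e * (z * x) ^+ 2 = Hy.
  transitivity (al * (z ^+ 2 * (x ^+ 2 * Hx)) + be * (Hy * (z * x) ^+ 2)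
    + ga * (x ^+ 2 * (z ^+ 2 * Hz))); first by rewrite /e; ring.
  by rewrite R1 -R2 -[RHS]mulr1 -bez; ring.
have E3 : e * (x * y) ^+ 2 = Hz.
  transitivity (al * (y ^+ 2 * (x ^+ 2 * Hx)) + be * (x ^+ 2 * (y ^+ 2 * Hy))
    + ga * (Hz * (x * y) ^+ 2)); first by rewrite /e; ring.
  by rewrite -R3 R2 -[RHS]mulr1 -bez; ring.
have Fd := top_cubic hx hy hz F0.
have top_e (a b : {poly C}) ad bd H h : top d a ad -> top d b bd ->
    top (4 + (d + d) + (d + d)) ('X^4 * H) h -> e * (a * b) ^+ 2 = H ->
    [/\ ad * bd != 0 -> e = (e`_0)%:P
      & e = (e`_0)%:P -> e`_0 * (ad * bd) ^+ 2 = h].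
  move=> ha hb hH eH; have hab := topM ha hb.
  have := topM (topXn C 4) (topM hab hab); rewrite mul1r -!expr2 => h4.
  rewrite -eH mulrCA in hH; split=> [n0|ec].
    by apply: top_quotient h4 _ hH; rewrite expf_neq0.
  rewrite ec in hH; apply: top_uniq hH; exact: (topM (topC _) h4).
have [k1 t1] := top_e _ _ _ _ _ _ hy hz H1 E1.
have [k2 t2] := top_e _ _ _ _ _ _ hz hx H2 E2.
have [k3 t3] := top_e _ _ _ _ _ _ hx hy H3 E3.
have nzd := two_nonzero b2_neq0 Fd nz.
have ec : e = (e`_0)%:P by case/or3P: nzd => ?; [exact: k1 | exact: k2 | exact: k3].
have {}t1 := t1 ec; have {}t2 := t2 ec; have {}t3 := t3 ec.
(* The factor [w4 ^+ 2] turns products of Wronskian coefficients into products of gradient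
   components times [c ^+ 2], which [grad_form] evaluates. *)
have at_top : w4 ^+ 2 * (e`_0 - 2 * d%:R * u) = c ^+ 2 * kappa2.
  have gr (a b f s t v : C) :
      cubic a2 b2 a b f = 0 ->
      w4 * s = - (c * grad a2 b2 a b f) -> w4 * t = - (c * grad a2 b2 b f a) ->
      w4 * v = - (c * grad a2 b2 f a b) ->
      e`_0 * (b * f) ^+ 2 = 2 * d%:R * u * (b * f) ^+ 2 + 3 * (b2 ^+ 2 * t * v) + a2 * b2 * s ^+ 2 ->
      b * f != 0 -> w4 ^+ 2 * (e`_0 - 2 * d%:R * u) = c ^+ 2 * kappa2.
    move=> Fabf hs ht hv he bf; apply: (mulIf (expf_neq0 2 bf)).
    transitivity (w4 ^+ 2 * (e`_0 * (b * f) ^+ 2 - 2 * d%:R * u * (b * f) ^+ 2)); first by ring.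
    rewrite he; transitivity (3 * (b2 ^+ 2 * (w4 * t) * (w4 * v)) + a2 * b2 * (w4 * s) ^+ 2); first by ring.
    rewrite hs ht hv -[RHS]mulrA /kappa2 -(grad_form Fabf); ring.
  have Fd' : cubic a2 b2 yd zd xd = 0 by rewrite -cubic_rot.
  have Fd'' : cubic a2 b2 zd xd yd = 0 by rewrite cubic_rot.
  by case/or3P: nzd; [apply: (gr xd yd zd) tp tq tr t1
    | apply: (gr yd zd xd) tq tr tp t2 | apply: (gr zd xd yd) tr tp tq t3].
(* The same at 0, where the degree is absent because the first term of [height_form] vanishes with
   [U]. *)
have at_zero : w0 ^+ 2 * e`_0 = c ^+ 2 * kappa0.
  have gr (a b f s t v : C) :
      cubic a0 b0 a b f = 0 ->
      w0 * s = - (c * grad a0 b0 a b f) -> w0 * t = - (c * grad a0 b0 b f a) ->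
      w0 * v = - (c * grad a0 b0 f a b) ->
      e`_0 * (b * f) ^+ 2 = 3 * (b0 ^+ 2 * t * v) + a0 * b0 * s ^+ 2 ->
      b * f != 0 -> w0 ^+ 2 * e`_0 = c ^+ 2 * kappa0.
    move=> Fabf hs ht hv he bf; apply: (mulIf (expf_neq0 2 bf)).
    rewrite -mulrA he.
    transitivity (3 * (b0 ^+ 2 * (w0 * t) * (w0 * v)) + a0 * b0 * (w0 * s) ^+ 2); first by ring.
    rewrite hs ht hv -[RHS]mulrA /kappa0 -(grad_form Fabf); ring.
  have Fz : cubic a0 b0 x.[0] y.[0] z.[0] = 0.
    by rewrite -A_0 -B_0 -horner_cubic F0 horner0.
  have Fz' : cubic a0 b0 y.[0] z.[0] x.[0] = 0 by rewrite -cubic_rot.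
  have Fz'' : cubic a0 b0 z.[0] x.[0] y.[0] = 0 by rewrite cubic_rot.
  have nz0 : ~ [/\ x.[0] = 0, y.[0] = 0 & z.[0] = 0].
    by case=> e1 e2 e3; have := pr 0; rewrite /root e1 e2 e3 eqxx.
  have he (a b : {poly C}) H : e * (a * b) ^+ 2 = H -> e`_0 * (a.[0] * b.[0]) ^+ 2 = H.[0].
    by move=> <-; rewrite hornerM ec hornerC horner_exp hornerM coefC.
  have {}E1 := he _ _ _ E1; have {}E2 := he _ _ _ E2; have {}E3 := he _ _ _ E3.
  rewrite Z1 in E1; rewrite Z2 in E2; rewrite Z3 in E3.
  by case/or3P: (two_nonzero b0_neq0 Fz nz0); [apply: (gr _ _ _ _ _ _ Fz zp zq zr E1)
    | apply: (gr _ _ _ _ _ _ Fz' zq zr zp E2) | apply: (gr _ _ _ _ _ _ Fz'' zr zp zq E3)].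
rewrite mulrBr [c ^+ 2 * (w4 ^+ 2 * _)]mulrCA [c ^+ 2 * (w0 ^+ 2 * _)]mulrCA.
by rewrite -at_zero -at_top; ring.
Qed.

Lemma slope_primitive x y z : cubic A B x y z = 0 -> primitive x y z ->
  exists c : C, slope A B theta c%:P x y z.
Proof.
move=> F0 pr; have [hx hy hz nz] := top_deg3 (primitive_neq0 pr).
exact: slope_exists F0 pr hx hy hz nz.
Qed.

Lemma height_primitive x y z c : cubic A B x y z = 0 -> primitive x y z ->
  slope A B theta c%:P x y z ->
  2 * (deg3 x y z)%:R * u * (w0 ^+ 2 * w4 ^+ 2)
    = c ^+ 2 * (w4 ^+ 2 * kappa0 - w0 ^+ 2 * kappa2).
Proof.
move=> F0 pr; have [hx hy hz nz] := top_deg3 (primitive_neq0 pr).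
exact: slope_height F0 pr hx hy hz nz.
Qed.

Lemma disc_poly_neq0 : 27 * B ^+ 3 + A ^+ 3 != 0.
Proof.
apply: contra_neq smooth0 => /(congr1 (horner^~ 0)).
rewrite horner0 hornerD mulr_natl hornerMn !horner_exp A_0 B_0 => <-.
by rewrite mulr_natl.
Qed.

End SlopePoly.

(** * The slope on points over the field of fractions *)

Section PointSlope.
Variables (C : numClosedFieldType) (A B : {poly C}) (theta : {poly C} -> {poly C}).
Hypothesis thetaM : forall x y, theta (x * y) = x * theta y + theta x * y.
Hypothesis thetaD : {morph theta : x y / x + y}.
Hypothesis thetaAB : theta A * B = A * theta B.
Hypothesis B_neq0 : B != 0.
Hypothesis disc_neq0 : 27 * B ^+ 3 + A ^+ 3 != 0.
Hypothesis slope_exists : forall x y z, cubic A B x y z = 0 -> primitive x y z ->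
  exists c : C, slope A B theta c%:P x y z.

(* [K] is the field of fractions of [{poly C}], with embedding [T]. *)
Variables (K : fieldType) (T : {rmorphism {poly C} -> K}).
Hypothesis T_eq0 : forall p, (T p == 0) = (p == 0).
Hypothesis T_ratio : forall x : K, exists n d, d != 0 /\ x = T n / T d.
Let m : K := T A / T B.

Let T_eq p q : (T p == T q) = (p == q).
Proof. by rewrite -subr_eq0 -rmorphB T_eq0 subr_eq0. Qed.

Let TB0 : T B != 0 :> K. Proof. by rewrite T_eq0. Qed.

Let K6 : 6 != 0 :> K.
Proof.
have -> : 6 = T 6 :> K by rewrite rmorph_nat.
by rewrite T_eq0 -polyC1 -(rmorph_nat polyC) polyC_eq0 pnatr_eq0.
Qed.

Let mE := hesse_smooth_ratio (T A) TB0.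

Let m_smooth : m ^+ 3 + 27 != 0.
Proof.
have -> : m ^+ 3 + 27 = T (27 * B ^+ 3 + A ^+ 3) / T B ^+ 3.
  by rewrite mE disc_morph.
by rewrite mulf_eq0 invr_eq0 expf_eq0 !T_eq0 (negPf disc_neq0) (negPf B_neq0).
Qed.

Definition frac_row (x y z : {poly C}) : 'rV[K]_3 := row3 (T x) (T y) (T z).

Let frac_row_neq0 x y z : (frac_row x y z != 0) = [|| x != 0, y != 0 | z != 0].
Proof.
apply/idP/idP => [/row3_neq0|]; rewrite ?(row3_0, row3_1, row3_2) ?T_eq0 //.
move=> h; apply/eqP => /row3_eqP; rewrite !(row3_0, row3_1, row3_2) !mxE.
move=> -[/eqP + /eqP + /eqP]; rewrite !T_eq0 => /eqP x0 /eqP y0 /eqP z0.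
by move: h; rewrite x0 y0 z0 eqxx.
Qed.

Let hesse_frac_row x y z : T B * hesse_form m (frac_row x y z) = T (cubic A B x y z).
Proof.
by rewrite hesse_form_ratio // cubic_morph.
Qed.

Let polar_frac_row x y z x' y' z' :
  T B * hesse_polar m (frac_row x y z) (frac_row x' y' z')
  = T (polar A B x y z x' y' z').
Proof.
by rewrite hesse_polar_ratio // polar_morph.
Qed.

(** The coordinates may have common factors, so that the secant and tangent formulas apply as they
    stand; [slope_rep] gives independence of the choice. *)
Definition has_slope (P : {vspace 'rV[K]_3}) (c : C) := exists x y z,
  [/\ P = <[frac_row x y z]>%VS, frac_row x y z != 0, cubic A B x y z = 0
    & slope A B theta c%:P x y z].

Let frac_row_scale f x y z : frac_row (f * x) (f * y) (f * z) = T f *: frac_row x y z.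
Proof. by apply/row3_eqP; rewrite !mxE /= !rmorphM. Qed.

Lemma primitive_representative P : on_hesse m P -> exists x y z,
  [/\ P = <[frac_row x y z]>%VS, frac_row x y z != 0, cubic A B x y z = 0 & primitive x y z].
Proof.
move=> /on_hesseP[v [v0 Fv ->]].
have [n0 [d0 [d00 e0]]] := T_ratio (v 0 0).
have [n1 [d1 [d10 e1]]] := T_ratio (v 0 1).
have [n2 [d2 [d20 e2]]] := T_ratio (v 0 2).
have D0 : T (d0 * d1 * d2) != 0 :> K by rewrite T_eq0 !mulf_neq0.
have vE : frac_row (n0 * d1 * d2) (n1 * d0 * d2) (n2 * d0 * d1) = T (d0 * d1 * d2) *: v.
  by rewrite /frac_row !rmorphM; apply: clear_denominators; rewrite ?T_eq0.
have nz : frac_row (n0 * d1 * d2) (n1 * d0 * d2) (n2 * d0 * d1) != 0.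
  by rewrite vE scaler_eq0 negb_or D0.
have := nz; rewrite frac_row_neq0 => /primitive_part[g [x [y [z [g0 ex ey ez pr]]]]].
have Tg0 : T g != 0 :> K by rewrite T_eq0.
have gE : T g *: frac_row x y z = T (d0 * d1 * d2) *: v.
  by rewrite -frac_row_scale -ex -ey -ez.
exists x, y, z; split=> //.
- by rewrite -(vline_scale (frac_row x y z) Tg0) gE vline_scale.
- by apply: contraNneq nz => e; rewrite vE -gE e scaler0.
- apply/eqP; rewrite -T_eq0 -hesse_frac_row mulf_eq0 (negPf TB0) /=.
  have /eqP : hesse_form m (T g *: frac_row x y z) = 0.
    by rewrite gE hesse_formZ Fv mulr0.
  by rewrite hesse_formZ mulf_eq0 expf_eq0 (negPf Tg0).
Qed.

Lemma has_slope_exists P : on_hesse m P -> exists c, has_slope P c.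
Proof.
move=> /primitive_representative[x [y [z [-> nz F0 pr]]]].
have [c hc] := slope_exists F0 pr.
by exists c, x, y, z.
Qed.

Lemma slope_rep P c x y z : has_slope P c -> P = <[frac_row x y z]>%VS ->
  frac_row x y z != 0 -> slope A B theta c%:P x y z.
Proof.
move=> [x' [y' [z' [-> nz' F0 hc]]]] e nz.
have [k k0 ke] := vline_eqP nz (esym e).
have [n [d [d0 kE]]] := T_ratio k.
have n0 : n != 0.
  by apply: contraNneq k0 => n0; rewrite kE n0 rmorph0 mul0r.
have Td0 : T d != 0 :> K by rewrite T_eq0.
have : frac_row (d * x) (d * y) (d * z) = frac_row (n * x') (n * y') (n * z').
  by rewrite !frac_row_scale ke scalerA kE mulrC divfK.
move=> /row3_eqP; rewrite !(row3_0, row3_1, row3_2) => -[/eqP + /eqP + /eqP].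
rewrite !T_eq => /eqP ex /eqP ey /eqP ez.
apply/(slopeZ A B thetaM _ _ _ _ d0); rewrite ex ey ez.
by apply/(slopeZ A B thetaM _ _ _ _ n0).
Qed.

Lemma has_slope_uniq P c c' : has_slope P c -> has_slope P c' -> c = c'.
Proof.
move=> hc [x [y [z [e nz F0 hc']]]]; have hc1 := slope_rep hc e nz.
apply: polyC_inj; apply: slope_uniq hc1 hc'.
apply/negPn; rewrite !negb_or !negbK; apply/negP => /and3P[/eqP g1 /eqP g2 /eqP g3].
have P3 : 3 != 0 :> {poly C} by rewrite -(rmorph_nat polyC) polyC_eq0 pnatr_eq0.
have [x0 y0 z0] := grad_smooth P3 B_neq0 disc_neq0 g1 g2 g3.
by move: nz; rewrite frac_row_neq0 x0 y0 z0 eqxx.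
Qed.

Let has_slope_tangential P c : on_hesse m P -> has_slope P c ->
  has_slope (hesse_third m P P) (- (2 * c)).
Proof.
move=> hP [x [y [z [e nz F0 hc]]]].
have TF : hesse_form m (frac_row x y z) = 0.
  by apply: (mulfI TB0); rewrite mulr0 hesse_frac_row F0 rmorph0.
rewrite e hesse_third_tangent //.
exists (x * (y ^+ 3 - z ^+ 3)), (y * (z ^+ 3 - x ^+ 3)), (z * (x ^+ 3 - y ^+ 3)).
have tE : frac_row (x * (y ^+ 3 - z ^+ 3)) (y * (z ^+ 3 - x ^+ 3)) (z * (x ^+ 3 - y ^+ 3))
    = hesse_tangential (frac_row x y z).
  by rewrite /hesse_tangential !(row3_0, row3_1, row3_2) /frac_row !(rmorphM, rmorphB, rmorphXn).
rewrite tE; split=> //.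
- exact: (hesse_tangential_neq0 m_smooth).
- apply/eqP; rewrite -T_eq0 -hesse_frac_row tE hesse_form_tangential TF.
  by rewrite !mulr0.
- rewrite rmorphN rmorphM rmorph_nat; exact: slope_tangential.
Qed.

Lemma has_slope_third P Q c c' : on_hesse m P -> on_hesse m Q ->
  has_slope P c -> has_slope Q c' -> has_slope (hesse_third m P Q) (- (c + c')).
Proof.
move=> hP hQ hc hc'.
have [PQ|PQ] := eqVneq P Q.
  rewrite -PQ in hc' *; rewrite -(has_slope_uniq hc hc') (_ : c + c = 2 * c); last by ring.
  exact: has_slope_tangential.
(* If the line is tangent at [X], then [Y] is the tangential point of [X] and
   the third point is [X]. *)
have tangent_case X Y a b u v : on_hesse m X -> on_hesse m Y -> has_slope X a ->
    has_slope Y b -> X = <[u]>%VS -> Y = <[v]>%VS -> u != 0 -> v != 0 -> X != Y ->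
    hesse_form m u = 0 -> hesse_form m v = 0 ->
    hesse_polar m u v = 0 -> has_slope (hesse_third m X Y) (- (a + b)).
  move=> hX hY ha hb eX eY u0 v0; rewrite eX eY => uv Fu Fv puv.
  have tY : hesse_third m X X = Y.
    by rewrite eX eY hesse_third_tangent // (hesse_tangent_line K6 m_smooth u0 v0 uv).
  have -> : b = - (2 * a).
    by apply: has_slope_uniq hb _; rewrite -tY; exact: has_slope_tangential.
  rewrite hesse_third_secant // puv scale0r subr0 vline_scale; last first.
    exact: hesse_no_line.
  by rewrite -eX (_ : - (a + - (2 * a)) = a) //; ring.
have [x [y [z [eP nz F0 hx]]]] := hc; have [x' [y' [z' [eQ nz' F0' hx']]]] := hc'.
have Fu : hesse_form m (frac_row x y z) = 0.
  by apply: (mulfI TB0); rewrite mulr0 hesse_frac_row F0 rmorph0.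
have Fv : hesse_form m (frac_row x' y' z') = 0.
  by apply: (mulfI TB0); rewrite mulr0 hesse_frac_row F0' rmorph0.
have [puv|puv] := eqVneq (hesse_polar m (frac_row x y z) (frac_row x' y' z')) 0.
  exact: tangent_case hP hQ hc hc' eP eQ nz nz' PQ Fu Fv puv.
have [pvu|pvu] := eqVneq (hesse_polar m (frac_row x' y' z') (frac_row x y z)) 0.
  rewrite hesse_thirdC // addrC.
  by apply: (tangent_case _ _ _ _ _ _ hQ hP hc' hc eQ eP nz' nz); rewrite 1?eq_sym.
pose a := polar A B x' y' z' x y z; pose b := polar A B x y z x' y' z'.
have a0 : a != 0 by rewrite -T_eq0 -polar_frac_row mulf_neq0.
have b0 : b != 0 by rewrite -T_eq0 -polar_frac_row mulf_neq0.
have uv : <[frac_row x y z]>%VS != <[frac_row x' y' z']>%VS by rewrite -eP -eQ.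
have rE : frac_row (a * x - b * x') (a * y - b * y') (a * z - b * z')
    = T B *: (hesse_polar m (frac_row x' y' z') (frac_row x y z) *: frac_row x y z
       - hesse_polar m (frac_row x y z) (frac_row x' y' z') *: frac_row x' y' z').
  rewrite scalerBr !scalerA !polar_frac_row -/a -/b.
  by apply/row3_eqP; rewrite !(row3_0, row3_1, row3_2) !mxE /= !(rmorphB, rmorphM).
exists (a * x - b * x'), (a * y - b * y'), (a * z - b * z'); split.
- by rewrite rE vline_scale // eP eQ hesse_third_secant.
- by rewrite rE scaler_eq0 negb_or TB0 hesse_secant_neq0.
- exact: cubic_secant.
- rewrite rmorphN rmorphD; exact: slope_secant.
Qed.

(** The neutral element is a flex, so its slope satisfies [c = - (c + c)]. *)
Lemma has_slope_zero : has_slope (hesse_zero K) 0.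
Proof.
have [c hc] := has_slope_exists (on_hesse_zero m).
have := has_slope_third (on_hesse_zero m) (on_hesse_zero m) hc hc.
rewrite hesse_third_zero // => /(has_slope_uniq hc)/eqP.
rewrite -addr_eq0 addrA (_ : c + c + c = 3 * c); last by ring.
by rewrite mulf_eq0 pnatr_eq0 /= => /eqP c0; rewrite -c0.
Qed.

Let onO := on_hesse_zero m.
Let on3 := on_hesse_third K6 m_smooth.

Lemma has_slope_opp P c : on_hesse m P -> has_slope P c -> has_slope (hesse_opp m P) (- c).
Proof. by move=> hP /(has_slope_third onO hP has_slope_zero); rewrite add0r. Qed.

Lemma has_slope_add P Q c c' : on_hesse m P -> on_hesse m Q ->
  has_slope P c -> has_slope Q c' -> has_slope (hesse_add m P Q) (c + c').
Proof.
move=> hP hQ hc hc'.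
by have := has_slope_opp (on3 hP hQ) (has_slope_third hP hQ hc hc'); rewrite opprK.
Qed.

Lemma has_slope_muln P c n : on_hesse m P -> has_slope P c ->
  has_slope (hesse_muln m P n) (n%:R * c).
Proof.
move=> hP hc; elim: n => [|n IH]; first by rewrite mul0r; exact: has_slope_zero.
rewrite /hesse_muln iterS -/(hesse_muln m P n) (_ : n.+1%:R * c = c + n%:R * c).
  by apply: has_slope_add => //; apply: on_hesse_muln.
by rewrite -natr1; ring.
Qed.

Lemma has_slope_mulz P c (n : int) : on_hesse m P -> has_slope P c ->
  has_slope (hesse_mulz m P n) (n%:~R * c).
Proof.
move=> hP hc; case: n => n; first exact: has_slope_muln.
rewrite NegzE mulrNz mulNr; apply: has_slope_opp; first exact: on_hesse_muln.
exact: has_slope_muln.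
Qed.

(** * From the height equation to generation modulo torsion *)

Variables k1 k2 : C.
Hypothesis height : forall x y z c, cubic A B x y z = 0 -> primitive x y z ->
  slope A B theta c%:P x y z -> (deg3 x y z)%:R * k1 = c ^+ 2 * k2.
Hypothesis k1_neq0 : k1 != 0.
Hypothesis constant_flex : forall a b c : C, cubic A B a%:P b%:P c%:P = 0 ->
  a * b * c = 0 /\ a ^+ 3 + b ^+ 3 + c ^+ 3 = 0.

Lemma has_slope_height P c : on_hesse m P -> has_slope P c ->
  exists d : nat, d%:R * k1 = c ^+ 2 * k2.
Proof.
move=> /primitive_representative[x [y [z [e nz F0 pr]]]] hc.
by exists (deg3 x y z); apply: height => //; apply: slope_rep hc e nz.
Qed.

(** Degree 0 makes the point constant, and a constant point on this non-constant pencil is one of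
    its nine base points, the common flexes of its smooth members. *)
Lemma slope0_torsion P : on_hesse m P -> has_slope P 0 -> hesse_torsion m P.
Proof.
move=> hP h0; apply: flex_torsion => //.
have [x [y [z [e nz F0 pr]]]] := primitive_representative hP.
have := height F0 pr (slope_rep h0 e nz); rewrite expr0n mul0r => /eqP.
rewrite mulf_eq0 (negPf k1_neq0) orbF pnatr_eq0 => /eqP d0.
have [[sx _] [sy _] [sz _] _] := top_deg3 (primitive_neq0 pr).
move: sx sy sz nz F0 e; rewrite d0 => /size1_polyC-> /size1_polyC-> /size1_polyC->.
move: (x`_0) (y`_0) (z`_0) => a b c nz F0 ->.
have [n0 s0] := constant_flex F0.
rewrite hesse_third_tangent //.
have tE : hesse_tangential (frac_row a%:P b%:P c%:P)
    = frac_row (a * (b ^+ 3 - c ^+ 3))%:P (b * (c ^+ 3 - a ^+ 3))%:P (c * (a ^+ 3 - b ^+ 3))%:P.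
  by rewrite /hesse_tangential !(row3_0, row3_1, row3_2) /frac_row !(rmorphM, rmorphB, rmorphXn).
(* With one coordinate 0 and the cubes of the others opposite, the tangential vector is a nonzero
   multiple of the point. *)
have key (k : C) : k != 0 -> a * (b ^+ 3 - c ^+ 3) = k * a -> b * (c ^+ 3 - a ^+ 3) = k * b ->
    c * (a ^+ 3 - b ^+ 3) = k * c ->
    <[hesse_tangential (frac_row a%:P b%:P c%:P)]>%VS = <[frac_row a%:P b%:P c%:P]>%VS.
  move=> k0 h1 h2 h3; rewrite tE h1 h2 h3 !polyCM frac_row_scale vline_scale //.
  by rewrite T_eq0 polyC_eq0.
have nz' : [|| a != 0, b != 0 | c != 0] by move: nz; rewrite frac_row_neq0 !polyC_eq0.
have cube0 (p q : C) : p ^+ 3 + q ^+ 3 = 0 -> (p != 0) || (q != 0) -> q != 0.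
  move=> pq; apply: contraTneq => q0; move: pq; rewrite q0 expr0n addr0 => /eqP.
  by rewrite expf_eq0 /= => /eqP ->; rewrite eqxx.
move: nz' s0 key; move/eqP: n0; rewrite !mulf_eq0 -orbA => /or3P[] /eqP ->; rewrite eqxx /=.
- move=> bc s0 key; have c0 : c != 0 by apply: cube0 bc; rewrite -s0; ring.
  have bE : b ^+ 3 = - c ^+ 3 by apply/eqP; rewrite -addr_eq0 -s0; apply/eqP; ring.
  by apply: (key (c ^+ 3)); rewrite ?expf_neq0 // ?bE; ring.
- move=> ac s0 key; have c0 : c != 0 by apply: cube0 ac; rewrite -s0; ring.
  have aE : a ^+ 3 = - c ^+ 3 by apply/eqP; rewrite -addr_eq0 -s0; apply/eqP; ring.
  by apply: (key (- c ^+ 3)); rewrite ?oppr_eq0 ?expf_neq0 // ?aE; ring.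
- rewrite orbF => ab s0 key; have b0 : b != 0 by apply: cube0 ab; rewrite -s0; ring.
  have aE : a ^+ 3 = - b ^+ 3 by apply/eqP; rewrite -addr_eq0 -s0; apply/eqP; ring.
  by apply: (key (b ^+ 3)); rewrite ?expf_neq0 // ?aE; ring.
Qed.

Variables (P1 : {vspace 'rV[K]_3}) (c1 : C).
Hypothesis on_P1 : on_hesse m P1.
Hypothesis slope_P1 : has_slope P1 c1.
Hypothesis height_P1 : k1 = c1 ^+ 2 * k2.

Let c1_neq0 : c1 != 0.
Proof. by apply: contra_neq k1_neq0 => c10; rewrite height_P1 c10 expr0n mul0r. Qed.

Let k2_neq0 : k2 != 0.
Proof. by apply: contra_neq k1_neq0 => k20; rewrite height_P1 k20 mulr0. Qed.

Lemma not_torsion_P1 : ~ hesse_torsion m P1.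
Proof.
move=> [n n0 e]; have := has_slope_muln n on_P1 slope_P1; rewrite e.
move=> /(has_slope_uniq has_slope_zero)/esym/eqP.
by rewrite mulf_eq0 (negPf c1_neq0) pnatr_eq0 orbF eqn0Ngt n0.
Qed.

Let height_ratio P c : on_hesse m P -> has_slope P c -> exists d : nat, (c / c1) ^+ 2 = d%:R.
Proof.
move=> hP hc; have [d hd] := has_slope_height hP hc; exists d.
apply: (mulIf k1_neq0); rewrite hd {1}height_P1.
by field.
Qed.

(* The ratio of the slopes is half an integer because its square and that of
   its successor are integers. *)
Lemma slope_ratio_int Q c : on_hesse m Q -> has_slope Q c ->
  exists n : int, c = n%:~R * c1.
Proof.
move=> hQ hc; have [d hd] := height_ratio hQ hc.
have [e he] := height_ratio (on_hesse_add K6 m_smooth hQ on_P1) (has_slope_add hQ on_P1 hc slope_P1).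
pose r := c / c1; have cE : c = r * c1 by rewrite /r divfK.
have {}he : (r + 1) ^+ 2 = e%:R by rewrite -he /r; congr (_ ^+ 2); field.
pose k : int := e%:Z - d%:Z - 1.
have kE : k%:~R = 2 * r.
  have -> : 2 * r = (r + 1) ^+ 2 - r ^+ 2 - 1 by ring.
  by rewrite he hd /k !rmorphB /= rmorph1.
have k4 : k ^+ 2 = 4 * d%:Z.
  apply: (@intr_inj C); rewrite rmorphXn rmorphM /= kE rmorph_nat.
  by rewrite -[d%:Z%:~R]/(d%:R) -hd -/r; ring.
(* [k] is twice the ratio [r], and 2 divides its square; so [r] itself is an integer. *)
have : (2 %| `|k|)%N.
  have : (2 %| `|k| ^ 2)%N.
    by rewrite -abszX k4 abszM dvdn_mulr.
  by rewrite Euclid_dvdX // andbT.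
move=> /dvdnP[j jk].
have [s sk] : exists s : int, k = s * 2.
  have [k0|k0] := leP 0 k.
    by exists j%:Z; rewrite -[LHS]gez0_abs // jk.
  by exists (- j%:Z); rewrite mulNr -[LHS]opprK -(ltz0_abs k0) jk.
exists s; rewrite cE; congr (_ * _); apply: (@mulfI _ 2); first by rewrite pnatr_eq0.
by rewrite -kE sk rmorphM /= mulrC.
Qed.

Lemma generates_P1 : hesse_generates_mod_torsion m P1.
Proof.
move=> Q hQ; have [c hc] := has_slope_exists hQ.
have [n cE] := slope_ratio_int hQ hc.
have hM := on_hesse_mulz K6 m_smooth n on_P1.
have hO := on_hesse_opp K6 m_smooth hQ.
(* The torsion part is Q - n P1, of slope [- (n c1 - c) = 0]. *)
exists n, (hesse_third m (hesse_mulz m P1 n) (hesse_opp m Q)); split.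
- exact: on3.
- apply: slope0_torsion; first exact: on3.
  have := has_slope_third hM hO (has_slope_mulz n on_P1 slope_P1) (has_slope_opp hQ hc).
  by rewrite cE subrr oppr0.
- by rewrite hesse_add_third.
Qed.

End PointSlope.

(** * The K3 surface for transcendental lambda *)

Section Instance.
Variables (R : realType) (l : R[i]).
Hypothesis l_transcendental : ~ algebraic_over_int l.

Let nonroot (p : {poly int}) : p != 0 -> (map_poly intr p).[l] != 0.
Proof. by move=> p0; apply/eqP => e; apply: l_transcendental; exists p => //; apply/eqP. Qed.

Let l_neq0 : l != 0.
Proof. by have := @nonroot 'X; rewrite polyX_eq0 map_polyX hornerX; apply. Qed.

(** Used for 1 and -8, where the fibre at [t = 0] or at infinity degenerates. *)
Let l3_neq n : l ^+ 3 - n%:~R != 0.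
Proof.
have := @nonroot ('X^3 - n%:P); rewrite rmorphB /= map_polyXn map_polyC /=.
by rewrite !hornerE; apply; rewrite -size_poly_eq0 size_XnsubC.
Qed.

Let a0 := 3 * l ^+ 3.
Let a2 := l ^+ 3 - 4.
Let b0 := - l ^+ 2.
Let b2 := l ^+ 2.

Let lm1 : l ^+ 3 - 1 != 0. Proof. exact: (l3_neq 1). Qed.
Let lp8 : l ^+ 3 + 8 != 0. Proof. by have := l3_neq (- 8); rewrite rmorphN opprK. Qed.

Let natC n : n.+1%:R != 0 :> R[i]. Proof. by rewrite pnatr_eq0. Qed.

Let u_neq0 : 2 * (a2 * b0 - a0 * b2) != 0.
Proof.
have -> : 2 * (a2 * b0 - a0 * b2) = - (8 * (l ^+ 2 * (l ^+ 3 - 1))) by rewrite /a0 /a2 /b0 /b2; ring.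
by rewrite oppr_eq0 !mulf_neq0 ?expf_neq0.
Qed.

Let b0_neq0 : b0 != 0. Proof. by rewrite oppr_eq0 expf_neq0. Qed.
Let b2_neq0 : b2 != 0. Proof. by rewrite expf_neq0. Qed.

Let smooth0 : 27 * b0 ^+ 3 + a0 ^+ 3 != 0.
Proof.
have -> : 27 * b0 ^+ 3 + a0 ^+ 3 = 27 * (l ^+ 6 * (l ^+ 3 - 1)) by rewrite /a0 /b0; ring.
by rewrite !mulf_neq0 ?expf_neq0.
Qed.

Let smooth2 : 27 * b2 ^+ 3 + a2 ^+ 3 != 0.
Proof.
have -> : 27 * b2 ^+ 3 + a2 ^+ 3 = (l ^+ 3 - 1) * (l ^+ 3 + 8) ^+ 2 by rewrite /a2 /b2; ring.
by rewrite !mulf_neq0 ?expf_neq0.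
Qed.

Let A : {poly R[i]} := a2%:P * 'X^2 + a0%:P.
Let B : {poly R[i]} := b2%:P * 'X^2 + b0%:P.

(** The coefficients of t^2 and 1 are two linear equations in abc and a^3 + b^3 + c^3, independent
    because [u_neq0]. *)
Let constant_flex (a b c : R[i]) : cubic A B a%:P b%:P c%:P = 0 ->
  a * b * c = 0 /\ a ^+ 3 + b ^+ 3 + c ^+ 3 = 0.
Proof.
set n := a * b * c; set s := _ + _ + _.
have -> : cubic A B a%:P b%:P c%:P = (a2 * n + b2 * s)%:P * 'X^2 + (a0 * n + b0 * s)%:P.
  by rewrite /cubic /A /B /n /s !(polyCD, polyCM, polyC_exp); ring.
move=> e; have e0 : a0 * n + b0 * s = 0.
  by have := congr1 (fun p : {poly R[i]} => p`_0) e; rewrite coefD coefCM coefXn coefC coef0 mulr0 add0r.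
have e2 : a2 * n + b2 * s = 0.
  by have := congr1 (fun p : {poly R[i]} => p`_2) e; rewrite coefD coefCM coefXn coefC coef0 mulr1 addr0.
split; apply: (mulfI u_neq0); rewrite mulr0.
  transitivity (2 * (b0 * (a2 * n + b2 * s) - b2 * (a0 * n + b0 * s))); first by ring.
  by rewrite e0 e2; ring.
transitivity (2 * (a2 * (a0 * n + b0 * s) - a0 * (a2 * n + b2 * s))); first by ring.
by rewrite e0 e2; ring.
Qed.

Let T : {rmorphism {poly R[i]} -> Ct R} := @tofrac {poly R[i]}.

Let EK3_coefE : EK3_coef l = T A / T B.
Proof.
rewrite /EK3_coef /Ct_const /Ct_t.
have -> : T A = tofrac l%:P ^+ 3 * (tofrac 'X ^+ 2 + 3) - 4 * tofrac 'X ^+ 2.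
  have -> : A = l%:P ^+ 3 * ('X ^+ 2 + 3) - 4 * 'X ^+ 2.
    rewrite /A /a2 /a0 !(polyCB, polyCM, polyC_exp).
    by rewrite !(rmorph_nat (@polyC R[i])); ring.
  by rewrite !(rmorphB, rmorphD, rmorphM, rmorphXn, rmorph_nat).
have -> // : T B = tofrac l%:P ^+ 2 * (tofrac 'X ^+ 2 - 1).
have -> : B = l%:P ^+ 2 * ('X ^+ 2 - 1).
  by rewrite /B /b2 /b0 polyCN !polyC_exp; ring.
by rewrite !(rmorphB, rmorphD, rmorphM, rmorphXn, rmorph1).
Qed.

Let x1 : {poly R[i]} := - 2 * 'X.
Let y1 : {poly R[i]} := l%:P * ('X + 1).
Let z1 : {poly R[i]} := l%:P * ('X - 1).

Let EK3_P1E : EK3_P1 l = <[row3 (T x1) (T y1) (T z1)]>%VS.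
Proof.
rewrite /EK3_P1 /Ct_const /Ct_t /x1 /y1 /z1.
by rewrite !(rmorphB, rmorphD, rmorphM, rmorphN, rmorph_nat, rmorph1).
Qed.

Let cubic1 : cubic A B x1 y1 z1 = 0.
Proof.
rewrite /cubic /A /B /x1 /y1 /z1 /a0 /a2 /b0 /b2.
rewrite !(polyCB, polyCM, polyC_exp, polyCN) !(rmorph_nat (@polyC R[i])).
by ring.
Qed.

Let primitive1 : primitive x1 y1 z1.
Proof.
move=> t; apply/negP => /and3P[_]; rewrite /root /y1 /z1 !hornerM !hornerD hornerN !hornerC hornerX.
rewrite !mulf_eq0 (negPf l_neq0) /= => /eqP h1 /eqP h2.
have : 2 = 0 :> R[i].
  by transitivity ((t + 1) - (t - 1)); [ring | rewrite h1 h2 subrr].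
by move/eqP; rewrite pnatr_eq0.
Qed.

Let deg1 : deg3 x1 y1 z1 = 1%N.
Proof.
have sy : size y1 = 2 by rewrite /y1 size_Cmul // -[1]opprK -polyCN size_XsubC.
have sz : size z1 = 2 by rewrite /z1 size_Cmul // size_XsubC.
have sx : (size x1 <= 2)%N.
  have -> : x1 = (- 2)%:P * 'X by rewrite /x1 rmorphN rmorph_nat.
  by rewrite size_Cmul ?oppr_eq0 // size_polyX.
by rewrite /deg3 sy sz (maxn_idPr sx).
Qed.

Lemma EK3_generated :
  [/\ on_hesse (EK3_coef l) (EK3_P1 l), ~ hesse_torsion (EK3_coef l) (EK3_P1 l)
    & hesse_generates_mod_torsion (EK3_coef l) (EK3_P1 l)].
Proof.
have [delta [dD dM dl]] := derivation_exists l_transcendental.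
have d1 : delta 1 = 0.
  by have := dM 1 1; rewrite !mul1r mulr1 => /eqP; rewrite -subr_eq0 opprD addNKr oppr_eq0 => /eqP.
have d0 : delta 0 = 0 by apply: (addrI (delta 0)); rewrite -dD !addr0.
have dN x : delta (- x) = - delta x by apply/eqP; rewrite -addr_eq0 -dD addNr d0.
have dn n : delta n%:R = 0 by elim: n => [|n IH]; rewrite ?d0 // -natr1 dD IH d1 addr0.
have d2 : delta (l ^+ 2) = 2 * l by rewrite expr2 dM dl; ring.
have d3 : delta (l ^+ 3) = 3 * l ^+ 2 by rewrite exprS dM d2 dl; ring.
have w0 : delta a0 * b0 - a0 * delta b0 != 0.
  rewrite /a0 /b0 dM dN dn d2 d3.
  have -> : (3 * (3 * l ^+ 2) + 0 * l ^+ 3) * - l ^+ 2 - 3 * l ^+ 3 * - (2 * l) = - (3 * l ^+ 4) by ring.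
  by rewrite oppr_eq0 mulf_neq0 ?expf_neq0.
have w4 : delta a2 * b2 - a2 * delta b2 != 0.
  rewrite /a2 /b2 dD dN dn d2 d3.
  have -> : (3 * l ^+ 2 + - 0) * l ^+ 2 - (l ^+ 3 - 4) * (2 * l) = l * (l ^+ 3 + 8) by ring.
  by rewrite mulf_neq0.
pose theta := transport delta a0 a2 b0 b2.
pose k1 := 4 * (a2 * b0 - a0 * b2) * ((delta a0 * b0 - a0 * delta b0) ^+ 2
  * (delta a2 * b2 - a2 * delta b2) ^+ 2).
pose k2 := (delta a2 * b2 - a2 * delta b2) ^+ 2 * (b0 * (27 * b0 ^+ 3 + a0 ^+ 3))
  - (delta a0 * b0 - a0 * delta b0) ^+ 2 * (b2 * (27 * b2 ^+ 3 + a2 ^+ 3)).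
have k1_neq0 : k1 != 0.
  have -> : k1 = 2 * (2 * (a2 * b0 - a0 * b2)) * ((delta a0 * b0 - a0 * delta b0) ^+ 2
    * (delta a2 * b2 - a2 * delta b2) ^+ 2) by rewrite /k1; ring.
  apply: mulf_neq0; first exact: mulf_neq0 (natC 1) u_neq0.
  by rewrite mulf_neq0 ?expf_neq0.
have height x y z c : cubic A B x y z = 0 -> primitive x y z ->
    slope A B theta c%:P x y z -> (deg3 x y z)%:R * k1 = c ^+ 2 * k2.
  move=> F0 pr hc; rewrite /k2 -(height_primitive dD b0_neq0 b2_neq0 F0 pr hc) /k1.
  by ring.
have B_neq0 : B != 0 := quad_neq0 b2 b0_neq0.
have slope_ex := slope_primitive dD dM u_neq0 b0_neq0 b2_neq0 smooth0 smooth2.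
have [c1 hc1] := slope_ex _ _ _ cubic1 primitive1.
have height1 : k1 = c1 ^+ 2 * k2.
  by rewrite -(height _ _ _ _ cubic1 primitive1 hc1) deg1 mul1r.
have TB0 : T B != 0 by rewrite tofrac_eq0.
have nz1 : row3 (T x1) (T y1) (T z1) != 0.
  apply/eqP => /row3_eqP[_]; rewrite row3_1 row3_2 !mxE => /eqP + /eqP.
  rewrite !tofrac_eq0 => /eqP y0 /eqP z0; have := primitive1 0.
  by rewrite y0 z0 !root0 /root /x1 hornerM hornerX mulr0 eqxx.
rewrite EK3_coefE EK3_P1E; set m := T A / T B; set P1 := vline _.
have on_P1 : on_hesse m P1.
  rewrite on_hesse_line //; apply/eqP/(mulfI TB0); rewrite mulr0.
  by rewrite hesse_form_ratio // -cubic_morph cubic1 rmorph0.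
have slope1 : has_slope A B theta T P1 c1 by exists x1, y1, z1.
have tM := transportM dD dM a0 a2 b0 b2; have tD := transportD dD a0 a2 b0 b2.
have tAB := transportAB delta a0 a2 b0 b2.
have disc := disc_poly_neq0 a2 b2 smooth0.
have T_eq0 p : (T p == 0) = (p == 0) by exact: tofrac_eq0.
have T_ratio (x : Ct R) : exists n d, d != 0 /\ x = T n / T d := fraction_ratio x.
split=> //.
- exact: (not_torsion_P1 tM tD tAB B_neq0 disc slope_ex T_eq0 T_ratio k1_neq0 on_P1 slope1 height1).
- exact: (generates_P1 tM tD tAB B_neq0 disc slope_ex T_eq0 T_ratio height k1_neq0
    constant_flex on_P1 slope1 height1).
Qed.

End Instance.

Theorem theorem27 (R : realType) :
  exists S : set R[i], countable S /\
    forall lambda : R[i], ~ S lambda ->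
      [/\ on_hesse (EK3_coef lambda) (EK3_P1 lambda),
          ~ hesse_torsion (EK3_coef lambda) (EK3_P1 lambda)
        & hesse_generates_mod_torsion (EK3_coef lambda) (EK3_P1 lambda)].
Proof.
(* The excluded values are the algebraic numbers. *)
exists (@algebraic_over_int R[i]); split; first exact: countable_algebraic_over_int.
by move=> lambda /EK3_generated.
Qed.
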